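(* Let $T$ be a complete theory expanding the theory of integral domains, with monster model $\mathbb M$, and let $\mathrm{cl}$ be an existential matroid on $\mathbb M$. Assume that $T$ is $\mathrm{cl}$-minimal. Then $T^d$ is also $\mathrm{cl}$-minimal, i.e. minimal with respect to its existential matroid $\mathrm{Scl}$. Moreover, $T^d$ coincides with $T^2$.
   Context: Conventions: a monster model of a complete theory $T$ (in a language $\mathcal L$, with only infinite models) is a $\kappa$-saturated, strongly $\kappa$-homogeneous model $\mathbb M$, for a large cardinal $\kappa>|T|$. ''Small'' means of cardinality $<\kappa$; ''definable'' means definable with parameters. A (finitary) matroid on $\mathbb M$ is an operator $\mathrm{cl}:\mathcal P(\mathbb M)\to\mathcal P(\mathbb M)$ with: $X\subseteq \mathrm{cl}(X)$; $X\subseteq Y\Rightarrow \mathrm{cl}(X)\subseteq \mathrm{cl}(Y)$; $\mathrm{cl}(\mathrm{cl}(X))=\mathrm{cl}(X)$; $\mathrm{cl}(X)=\bigcup\{\mathrm{cl}(A): A\subseteq X \text{ finite}\}$; and exchange: $a\in \mathrm{cl}(X\cup\{c\})\setminus \mathrm{cl}(X)$ implies $c\in\mathrm{cl}(X\cup\{a\})$. A formula $\phi(x,\bar y)$ without parameters, $x$ a single variable, is $x$-narrow if for all $a,\bar b$, $\mathbb M\models\phi(a,\bar b)$ implies $a\in\mathrm{cl}(\bar b)$. The matroid is definable if for every $A$, $\mathrm{cl}(A)$ is the union of the sets $\phi(\mathbb M,\bar a)$ with $\phi$ $x$-narrow and $\bar a$ a finite tuple from $A$. It satisfies Existence if for every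 element $a$ and all small $B,C$ with $a\notin\mathrm{cl}(B)$ there is $a'$ with the same type as $a$ over $B$ and $a'\notin\mathrm{cl}(B\cup C)$. The trivial matroid is $\mathrm{cl}^0(X)=\mathbb M$ for all $X$. An existential matroid is a definable matroid that satisfies Existence and is not trivial. Via the $x$-narrow formulas, $\mathrm{cl}$ transfers to any other monster model of $T$. $\mathrm{rk}(\bar b/A)$ is the cardinality of a maximal subtuple of $\bar b$ that is $\mathrm{cl}$-independent over $A$. For $V\subseteq\mathbb M^n$ definable (or a type) over a small $A$, $\dim(V)=\max\{\mathrm{rk}(\bar b/A):\bar b\in V\}$, $\dim(\emptyset)=-\infty$. Under the present hypotheses this dimension is definable in families. A type $p\in S_n(A)$ is generic if $\dim(p)=n$. $\mathbb M$ (equivalently $T$) is $\mathrm{cl}$-minimal if for every small $A\subset\mathbb M$ there is exactly one generic $1$-type over $A$. Let $\mathbb K\models T$, viewed as an elementary substructure of a monster model; the dimension of a $\mathbb K$-definable set is that of its interpretation in the monster model. $X\subseteq\mathbb K$ is dense in $\mathbb K$ if $U\cap X\neq\emptyset$ for every $\mathbb K$-definable $U\subseteq\mathbb K$ with $\dim(U)=1$; $X$ is $\mathrm{cl}$-closed in $\mathbb K$ if $\mathrm{cl}(X)\cap\mathbb K=X$. $\mathcal L^2$ is $\mathcal L$ with a new unary predicate $P$. $T^2$ is the $\mathcal L^2$-theory whose models are the pairs $\langle\mathbb K,\mathbb F\rangle$ with $\mathbb K\models T$, $\mathbb F=P(\mathbb K)\prec\mathbb K$, $\mathbb F\neq\mathbb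 K$ and $\mathbb F$ $\mathrm{cl}$-closed in $\mathbb K$. $T^d$ is the $\mathcal L^2$-theory whose models are the pairs $\langle\mathbb K,\mathbb F\rangle$ with $\mathbb K\models T$ and $\mathbb F$ a proper subset of $\mathbb K$ that is $\mathrm{cl}$-closed and dense in $\mathbb K$ (it then follows that $\mathbb F\prec\mathbb K$); it is complete. On a monster model $\langle\mathbb B^*,\mathbb A^*\rangle$ of $T^d$ one has the existential matroid $\mathrm{Scl}(X):=\mathrm{cl}(X\cup\mathbb A^* )$. *)

(* Defs.v *)
From mathcomp Require Import all_boot.
From mathcomp Require Import boolp classical_sets functions cardinality.

Set Implicit Arguments.
Unset Strict Implicit.
Unset Printing Implicit Defensive.

Local Open Scope classical_set_scope.
Local Open Scope card_scope.

(** * First-order logic *)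

Record language := Language {
  func : nat -> Type;
  rel_symb : nat -> Type }.

(* [term L n] and [formula L n] have their free variables indexed by ['I_n]. *)
Inductive term (L : language) (n : nat) : Type :=
| Var of 'I_n
| App k of func L k & ('I_k -> term L n).

(* [All] binds the variable 0 of its argument. *)
Inductive formula (L : language) : nat -> Type :=
| Bot n : formula L n
| Eq n of term L n & term L n : formula L n
| Rel n k of rel_symb L k & ('I_k -> term L n) : formula L n
| Imp n of formula L n & formula L n : formula L n
| All n of formula L n.+1 : formula L n.

Definition Neg L n (phi : formula L n) : formula L n := Imp phi (Bot L n).

Record structure (L : language) := Structure {
  carrier :> Type;
  fun_interp : forall k, func L k -> ('I_k -> carrier) -> carrier;
  rel_interp : forall k, rel_symb L k -> ('I_k -> carrier) -> Prop }.

Definition vcat (M : Type) m n (u : 'I_m -> M) (v : 'I_n -> M) : 'I_(m + n) -> M :=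
  fun i => match fintype.split i with inl j => u j | inr j => v j end.

Fixpoint eval L (M : structure L) n (v : 'I_n -> M) (t : term L n) : M :=
  match t with
  | Var i => v i
  | App k f ts => fun_interp f (fun i => eval v (ts i))
  end.

Fixpoint sat L (M : structure L) n (phi : formula L n) : ('I_n -> M) -> Prop :=
  match phi in formula _ n return ('I_n -> M) -> Prop with
  | Bot _ => fun=> False
  | Eq _ t u => fun v => eval v t = eval v u
  | Rel _ k R ts => fun v => rel_interp R (fun i => eval v (ts i))
  | Imp _ phi psi => fun v => sat phi v -> sat psi v
  | All _ phi => fun v => forall x : M, sat phi (vcat (fun _ : 'I_1 => x) v)
  end.

Definition sentence L := formula L 0.
Definition theory L := set (sentence L).

Definition holds L (M : structure L) (phi : sentence L) : Prop :=
  forall v : 'I_0 -> M, sat phi v.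

Definition models L (M : structure L) (T : theory L) : Prop :=
  forall phi, T phi -> holds M phi.

Definition entails L (T : theory L) (phi : sentence L) : Prop :=
  forall M : structure L, models M T -> holds M phi.

Definition complete L (T : theory L) : Prop :=
  (exists M : structure L, models M T) /\
  (forall phi, entails T phi \/ entails T (Neg phi)).

Definition only_infinite_models L (T : theory L) : Prop :=
  forall M : structure L, models M T -> infinite_set [set: M].

Definition elementary L (N M : structure L) (e : N -> M) : Prop :=
  forall n (phi : formula L n) (v : 'I_n -> N), sat phi v <-> sat phi (e \o v).

Definition fun_closed L (K : structure L) (F : set K) : Prop :=
  forall k (f : func L k) (v : 'I_k -> K), (forall i, F (v i)) -> F (fun_interp f v).

Definition substructure L (K : structure L) (F : set K) (h : fun_closed F) :
    structure L :=
  @Structure L {x : K | F x}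
    (fun k f v => exist F (fun_interp f (fun i => sval (v i)))
                          (h k f _ (fun i => svalP (v i))))
    (fun k R v => rel_interp R (fun i => sval (v i))).

Definition elementary_substructure L (K : structure L) (F : set K) : Prop :=
  exists h : fun_closed F, elementary (fun x : substructure h => sval x).

(** * Parameters, types, monster models *)

(* A formula in [n] variables with parameters: the last variables of [pform]
   are replaced by the tuple [ppar]. *)
Record pformula L (M : structure L) (n : nat) := PFormula {
  psize : nat;
  pform : formula L (n + psize);
  ppar : 'I_psize -> M }.
Arguments ppar {L M n} p _.

Definition psat L (M : structure L) n (phi : pformula M n) (v : 'I_n -> M) : Prop :=
  sat (pform phi) (vcat v (ppar phi)).

Definition pneg L (M : structure L) n (phi : pformula M n) : pformula M n :=
  PFormula (Neg (pform phi)) (ppar phi).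

Definition over L (M : structure L) (A : set M) n : set (pformula M n) :=
  [set phi | forall i, A (ppar phi i)].

Definition realizations L (M : structure L) n (p : set (pformula M n)) :
    set ('I_n -> M) :=
  [set v | forall phi, p phi -> psat phi v].

(* The elements of S_n(A). *)
Definition complete_type L (M : structure L) (A : set M) n
    (p : set (pformula M n)) : Prop :=
  [/\ p `<=` @over L M A n,
      forall s, finite_set s -> s `<=` p -> realizations s !=set0
    & forall phi, @over L M A n phi -> p phi \/ p (pneg phi)].

Definition tp L (M : structure L) (A : set M) n (v : 'I_n -> M) :
    set (pformula M n) :=
  [set phi | over A phi /\ psat phi v].

(* Cardinals are represented by types. *)
Definition card_lt T U (A : set T) (B : set U) : Prop := A #<= B /\ ~ (B #<= A).

Definition small (kappa T : Type) (A : set T) : Prop := card_lt A [set: kappa].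

Definition saturated (kappa : Type) L (M : structure L) : Prop :=
  forall A : set M, small kappa A ->
  forall n (p : set (pformula M n)), complete_type A p -> realizations p !=set0.

Definition automorphism L (M : structure L) (g : M -> M) : Prop :=
  [/\ bijective g,
      forall k (f : func L k) v, g (fun_interp f v) = fun_interp f (g \o v)
    & forall k (R : rel_symb L k) v, rel_interp R v <-> rel_interp R (g \o v)].

Definition elementary_on L (M : structure L) (A : set M) (f : M -> M) : Prop :=
  forall n (phi : formula L n) (v : 'I_n -> M), (forall i, A (v i)) ->
    (sat phi v <-> sat phi (f \o v)).

Definition strongly_homogeneous (kappa : Type) L (M : structure L) : Prop :=
  forall (A : set M) (f : M -> M), small kappa A -> elementary_on A f ->
  exists2 g, automorphism g & forall x, A x -> g x = f x.

(* The cardinality of a theory is that of the set of formulas of its language. *)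
Definition monster (kappa : Type) L (M : structure L) : Prop :=
  [/\ card_lt [set: {n & formula L n}] [set: kappa],
      saturated kappa M
    & strongly_homogeneous kappa M].

(** * Matroids *)

Definition matroid (M : Type) (cl : set M -> set M) : Prop :=
  [/\ forall X, X `<=` cl X,
      forall X Y, X `<=` Y -> cl X `<=` cl Y,
      forall X, cl (cl X) = cl X,
      forall X, cl X = \bigcup_(A in [set A | finite_set A /\ A `<=` X]) cl A
    & forall X a c, (cl (X `|` [set c]) `\` cl X) a -> cl (X `|` [set a]) c].

(* The distinguished variable x is the variable 0. *)
Definition narrow L (M : structure L) (cl : set M -> set M) n
    (phi : formula L (1 + n)) : Prop :=
  forall (a : M) (b : 'I_n -> M), sat phi (vcat (fun _ : 'I_1 => a) b) -> cl (range b) a.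

(* The operator that the narrow formulas of [(M, cl)] define on [N]. *)
Definition transfer L (M : structure L) (cl : set M -> set M) (N : structure L)
    (X : set N) : set N :=
  [set a | exists n (phi : formula L (1 + n)) (b : 'I_n -> N),
     [/\ narrow cl phi, forall i, X (b i) & sat phi (vcat (fun _ : 'I_1 => a) b)]].

Definition definable_matroid L (M : structure L) (cl : set M -> set M) : Prop :=
  forall A, cl A = transfer cl A.

Definition existence (kappa : Type) L (M : structure L) (cl : set M -> set M) : Prop :=
  forall (a : M) (B C : set M), small kappa B -> small kappa C -> ~ cl B a ->
  exists a' : M, tp B (fun _ : 'I_1 => a') = tp B (fun _ : 'I_1 => a)
                 /\ ~ cl (B `|` C) a'.

Definition existential_matroid (kappa : Type) L (M : structure L)
    (cl : set M -> set M) : Prop :=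
  [/\ matroid cl, definable_matroid cl, existence kappa cl & cl <> fun=> [set: M]].

Definition independent (M : Type) (cl : set M -> set M) (A : set M) n
    (b : 'I_n -> M) (I : {set 'I_n}) : Prop :=
  forall i, i \in I -> ~ cl (A `|` [set b j | j in [set j | j \in I :\ i]]) (b i).

Definition rk (M : Type) (cl : set M -> set M) (A : set M) n (b : 'I_n -> M) : nat :=
  \max_(I : {set 'I_n} | `[< independent cl A b I >]) #|I|.

(* [dim V = d], for [V] defined over [A]; it holds for no [d] if [V] is empty. *)
Definition has_dim (M : Type) (cl : set M -> set M) (A : set M) n
    (V : set ('I_n -> M)) (d : nat) : Prop :=
  (exists2 b, V b & rk cl A b = d) /\ (forall b, V b -> rk cl A b <= d).

Definition generic L (M : structure L) (cl : set M -> set M) (A : set M) n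
    (p : set (pformula M n)) : Prop :=
  has_dim cl A (realizations p) n.

Definition cl_minimal (kappa : Type) L (M : structure L) (cl : set M -> set M) : Prop :=
  forall A : set M, small kappa A ->
  exists! p : set (pformula M 1), complete_type A p /\ generic cl A p.

(** * Expansions of integral domains *)

Record ring_symbols (L : language) := RingSymbols {
  rs_zero : func L 0;
  rs_one : func L 0;
  rs_add : func L 2;
  rs_opp : func L 1;
  rs_mul : func L 2 }.

Definition is_integral_domain (D : Type) (zero one : D) (add mul : D -> D -> D)
    (opp : D -> D) : Prop :=
  [/\ [/\ associative add, commutative add, left_id zero add & left_inverse zero opp add],
      [/\ associative mul, commutative mul, left_id one mul & left_distributive mul add],
      one <> zero
    & forall x y, mul x y = zero -> x = zero \/ y = zero].

Definition expands_integral_domains L (S : ring_symbols L) (T : theory L) : Prop :=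
  forall N : structure L, models N T ->
  let op0 (f : func L 0) : N := fun_interp f (fun i : 'I_0 => match notF (ltn_ord i) with end) in
  let op1 (f : func L 1) (x : N) : N := fun_interp f (fun=> x) in
  let op2 (f : func L 2) (x y : N) : N :=
    fun_interp f (fun i : 'I_2 => if i == ord0 then x else y) in
  is_integral_domain (op0 (rs_zero S)) (op0 (rs_one S))
    (op2 (rs_add S)) (op2 (rs_mul S)) (op1 (rs_opp S)).

(** * Pairs *)

Inductive pair_rel (L : language) : nat -> Type :=
| Old k of rel_symb L k : pair_rel L k
| PSymb : pair_rel L 1.

Definition pair_language (L : language) := Language (func L) (pair_rel L).

Definition reduct L (N : structure (pair_language L)) : structure L :=
  @Structure L N (fun k (f : func L k) v => @fun_interp (pair_language L) N k f v)
    (fun k (R : rel_symb L k) v => @rel_interp (pair_language L) N k (Old R) v).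

Definition Pset L (N : structure (pair_language L)) : set (reduct N) :=
  [set x | @rel_interp (pair_language L) N 1 (PSymb L) (fun=> x)].

(* For an elementary embedding [e] of [K] in a monster model [M']: the trace
   of cl on [K] fixes [X], resp. [X] meets every [K]-definable subset of [K]
   whose interpretation in [M'] has dimension 1. *)
Definition closed_in L (M : structure L) (cl : set M -> set M) (K M' : structure L)
    (e : K -> M') (X : set K) : Prop :=
  e @^-1` (transfer cl (e @` X)) = X.

Definition dense_in L (M : structure L) (cl : set M -> set M) (K M' : structure L)
    (e : K -> M') (X : set K) : Prop :=
  forall n (phi : formula L (1 + n)) (b : 'I_n -> K),
    has_dim (@transfer L M cl M') (range (e \o b))
      [set v : 'I_1 -> M' | sat phi (vcat v (e \o b))] 1 ->
    exists2 x, X x & sat phi (vcat (fun _ : 'I_1 => x) b).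

Definition monster_embedding L (T : theory L) (kappa' : Type) (K M' : structure L)
    (e : K -> M') : Prop :=
  [/\ models M' T, monster kappa' M' & elementary e].

(* Membership in the class of models of T^2, resp. of T^d: the reduct to [L]
   is viewed as an elementary substructure of some monster model of [T], which
   always exists. *)
Definition models_T2 L (T : theory L) (M : structure L) (cl : set M -> set M)
    (N : structure (pair_language L)) : Prop :=
  exists (kappa' : Type) (M' : structure L) (e : reduct N -> M'),
    monster_embedding T kappa' e /\
    [/\ models (reduct N) T, elementary_substructure (@Pset L N),
        @Pset L N <> setT & closed_in cl e (@Pset L N)].

Definition models_Td L (T : theory L) (M : structure L) (cl : set M -> set M)
    (N : structure (pair_language L)) : Prop :=
  exists (kappa' : Type) (M' : structure L) (e : reduct N -> M'),
    monster_embedding T kappa' e /\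
    [/\ models (reduct N) T, @Pset L N <> setT,
        closed_in cl e (@Pset L N) & dense_in cl e (@Pset L N)].

Definition Scl L (M : structure L) (cl : set M -> set M)
    (N : structure (pair_language L)) (X : set (reduct N)) :
    set (reduct N) :=
  transfer cl (X `|` @Pset L N).

(* Main.v *)
(* Call a definable subset of a line large when its dimension is 1. By cl-minimality the large
   sets over a given set form a complete type, and largeness is first-order: [phi] is large iff for
   every [c] the map [(x, y) |-> x + c y] is not injective on [phi x phi] (two independent elements
   of a large set would otherwise both lie in the closure of their image, while in a small set a
   collision puts [c] in the closure of the parameters). Thus a quantifier over generic elements is
   available inside the language and can be used to eliminate parameters.

   T^2 = T^d. If an elementary closed [F] missed a large set, then [F] would be contained in a
   narrow set [chi(K, z)]. Coordinates of [z] are removed one at a time, by an existential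
   quantifier when they are in the closure of [F] and the others, by the generic quantifier
   otherwise; in the end [z] is in [F], and elementarity makes [chi] cover [K]. The converse is the
   Tarski-Vaught test.

   Minimality of T^d. Any two elements outside [cl(A u P)] have the same type over [A] by a
   back-and-forth between tuples with the same type in [L] and the same trace on [P] that are free
   from [P] over that trace. For the elements outside [cl(z u P)] to exist, no narrow [chi] may
   cover the model by the sets [chi(N, z, w)] with [w] in [P^k]: otherwise apply the covering to
   the polynomials [q_0 + q_1 y + ... + q_k y^k] with [y] outside [P] and the [q_i] in [P]
   independent, make [y] generic, and recover the [q_i] by interpolation at [k + 1] independent
   points; they end up in the closure of [k] elements, against Steinitz. *)
Require Import Defs.
From HB Require Import structures.
From mathcomp Require Import all_boot ssralg poly ring.
From mathcomp Require Import boolp classical_sets functions cardinality filter.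

Set Implicit Arguments.
Unset Strict Implicit.
Unset Printing Implicit Defensive.

Local Open Scope classical_set_scope.
Local Open Scope card_scope.

(** * Relations on sequences of variables *)

Definition scons (T : Type) (x : T) (z : nat -> T) : nat -> T :=
  fun i => if i is j.+1 then z j else x.

Definition mix (T : Type) (u z : nat -> T) : nat -> T :=
  fun i => if odd i then z i./2 else u i./2.

Lemma sconsE (T : Type) (v : nat -> T) : scons (v 0) (v \o S) = v.
Proof. by apply: funext => -[]. Qed.

Lemma mix_even (T : Type) (u z : nat -> T) : mix u z \o double = u.
Proof. by apply: funext => i; rewrite /mix /= odd_double doubleK. Qed.

Lemma mix_odd (T : Type) (u z : nat -> T) : mix u z \o (fun i => i.*2.+1) = z.
Proof. by apply: funext => i; rewrite /mix /= odd_double uphalf_double. Qed.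

Lemma comp_scons (T U : Type) (f : T -> U) x z :
  f \o scons x z = scons (f x) (f \o z).
Proof. by apply: funext => -[]. Qed.

Lemma range_scons (T : Type) x (z : nat -> T) :
  range (scons x z) = range z `|` [set x].
Proof.
apply/seteqP; split=> [_ [[|i] _ <-]|_ [[i _ <-]|->]].
- by right.
- by left; exists i.
- by exists i.+1.
- by exists 0.
Qed.

Lemma range_mix (T : Type) (u z : nat -> T) :
  range (mix u z) = range u `|` range z.
Proof.
apply/seteqP; split=> [_ [i _ <-]|x].
  by rewrite /mix; case: odd; [right|left]; exists i./2.
case=> -[i _ <-]; [exists i.*2|exists i.*2.+1] => //.
  by rewrite -[in RHS](mix_even u z).
by rewrite -[in RHS](mix_odd u z).
Qed.

(** * Substitution of variables in formulas *)

Section Renaming.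
Variable L : language.

Definition lift_var m n (f : 'I_m -> 'I_n) (i : 'I_(1 + m)) : 'I_(1 + n) :=
  match fintype.split i with inl j => lshift n j | inr j => rshift 1 (f j) end.

Fixpoint rename_term m n (f : 'I_m -> 'I_n) (t : term L m) : term L n :=
  match t with
  | Var i => Var L (f i)
  | App k g ts => App g (fun i => rename_term f (ts i))
  end.

Fixpoint rename m (phi : formula L m) : forall n, ('I_m -> 'I_n) -> formula L n :=
  match phi in formula _ m return forall n, ('I_m -> 'I_n) -> formula L n with
  | Bot _ => fun n _ => Bot L n
  | Eq _ t u => fun n f => Eq (rename_term f t) (rename_term f u)
  | Rel _ k R ts => fun n f => Rel R (fun i => rename_term f (ts i))
  | Imp _ phi psi => fun n f => Imp (rename phi f) (rename psi f)
  | All _ phi => fun n f => All (rename phi (lift_var f))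
  end.

Lemma eval_rename (N : structure L) m n (f : 'I_m -> 'I_n) (v : 'I_n -> N) t :
  eval v (rename_term f t) = eval (v \o f) t.
Proof.
by elim: t => //= k g ts IH; congr fun_interp; apply: funext => i; rewrite IH.
Qed.

Lemma vcat_lift (T : Type) m n (f : 'I_m -> 'I_n) (v : 'I_n -> T) (x : T) :
  vcat (fun _ : 'I_1 => x) v \o lift_var f = vcat (fun _ : 'I_1 => x) (v \o f).
Proof.
apply: funext => i; rewrite /vcat /lift_var /=.
by case: (fintype.split i) => j;
  rewrite -?[lshift _ _]/(unsplit (inl _)) -?[rshift _ _]/(unsplit (inr _)) unsplitK.
Qed.

Lemma sat_rename (N : structure L) m (phi : formula L m) n (f : 'I_m -> 'I_n)
    (v : 'I_n -> N) :
  sat (rename phi f) v <-> sat phi (v \o f).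
Proof.
elim: phi n f v => {m} [m|m t u|m k R ts|m phi IH psi IH'|m phi IH] n f v //=.
- by rewrite !eval_rename.
- by under eq_fun do rewrite eval_rename.
- by rewrite IH IH'.
- by split=> h x; have := h x; rewrite IH vcat_lift.
Qed.

End Renaming.

Definition res (T : Type) n (v : nat -> T) : 'I_n -> T := fun i => v i.

(* [D] is defined by one formula in all structures; variables are indexed by [nat] so that no
   dependent arities appear. *)
Definition fo (L : language) (D : forall N : structure L, (nat -> N) -> Prop) : Prop :=
  exists n (phi : formula L n), forall (N : structure L) v, sat phi (res v) <-> D N v.

Lemma vcat_res (T : Type) n (x : T) (v : nat -> T) :
  vcat (fun _ : 'I_1 => x) (@res T n v) = @res T (1 + n) (scons x v).
Proof.
apply: funext => i; rewrite /vcat; case: (split_ordP i) => j ->; last by [].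
by case: j => -[].
Qed.

Section FirstOrder.
Variable L : language.
Implicit Types D E : forall N : structure L, (nat -> N) -> Prop.

Lemma fo_ext D E : (forall N v, D N v <-> E N v) -> fo D -> fo E.
Proof.
by move=> h [n [phi H]]; exists n, phi => N v; rewrite H.
Qed.

Lemma fo_sat n (phi : formula L n) : fo (fun N v => sat phi (res v)).
Proof. by exists n, phi. Qed.

Lemma fo_support D : fo D ->
  exists n, forall (N : structure L) v v', (forall i, i < n -> v i = v' i) -> D N v -> D N v'.
Proof.
case=> n [phi H]; exists n => N v v' e; rewrite -!H.
suff -> : @res N n v = res v' by [].
by apply: funext => i; apply: e.
Qed.

(** The formula given by [fo D] may mention further variables. They have no influence, so all of
    them are renamed to the variable 0, which exists because [0 < n]. *)
Lemma fo_bounded D n : fo D -> 0 < n ->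
  (forall (N : structure L) v v', (forall i, i < n -> v i = v' i) -> D N v -> D N v') ->
  exists phi : formula L n, forall (N : structure L) v, sat phi (res v) <-> D N v.
Proof.
case=> m [phi H] n0 dep.
exists (rename phi (fun i : 'I_m => insubd (Ordinal n0) (val i))) => N v.
pose w i := if i < n then v i else v 0.
rewrite sat_rename; have -> : res v \o (fun i : 'I_m => insubd (Ordinal n0) (val i)) = res w.
  by apply: funext => i; rewrite /res /= val_insubd /w; case: ifP.
by rewrite H; split; apply: dep => i lt; rewrite /w lt.
Qed.

Lemma fo_common D E : fo D -> fo E -> exists n (phi psi : formula L n.+1),
  forall (N : structure L) v, (sat phi (res v) <-> D N v) /\ (sat psi (res v) <-> E N v).
Proof.
move=> fD fE; have [n Hn] := fo_support fD; have [m Hm] := fo_support fE.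
have [|phi Hphi] := fo_bounded (n := (n + m).+1) fD isT.
  by move=> N v v' e; apply: Hn => i ltin; apply: e; rewrite ltnS ltnW// ltn_addr.
have [|psi Hpsi] := fo_bounded (n := (n + m).+1) fE isT.
  by move=> N v v' e; apply: Hm => i ltin; apply: e; rewrite ltnS ltnW// ltn_addl.
by exists (n + m), phi, psi.
Qed.

Lemma fo_imp D E : fo D -> fo E -> fo (fun N v => D N v -> E N v).
Proof.
move=> fD fE; have [n [phi [psi H]]] := fo_common fD fE.
by exists n.+1, (Imp phi psi) => N v /=; have [-> ->] := H N v.
Qed.

Lemma fo_false : fo (fun (N : structure L) (v : nat -> N) => False).
Proof. by exists 0, (Bot L 0). Qed.

Lemma fo_not D : fo D -> fo (fun N v => ~ D N v).
Proof. by move=> fD; apply: fo_imp fD fo_false. Qed.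

Lemma fo_and D E : fo D -> fo E -> fo (fun N v => D N v /\ E N v).
Proof.
move=> fD fE; apply: fo_ext (fo_not (fo_imp fD (fo_not fE))) => N v.
by split=> [/not_implyP[? /contrapT]|[d e h]]; [|exact: h].
Qed.

Lemma fo_or D E : fo D -> fo E -> fo (fun N v => D N v \/ E N v).
Proof.
move=> fD fE; apply: fo_ext (fo_imp (fo_not fD) fE) => N v.
split=> [h|[//|//]]; have [?|/h] := pselect (D N v); tauto.
Qed.

Lemma fo_all (E : forall N : structure L, (nat -> N) -> N -> Prop) :
  fo (fun N v => E N (fun i => v i.+1) (v 0)) -> fo (fun N v => forall x, E N v x).
Proof.
move=> fE; have [n [phi [psi H]]] := fo_common fE fE.
exists n, (All phi) => N v /=.
by split=> h x; have := h x; have [] := (H N (scons x v)).1; rewrite vcat_res.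
Qed.

Lemma fo_ex (E : forall N : structure L, (nat -> N) -> N -> Prop) :
  fo (fun N v => E N (fun i => v i.+1) (v 0)) -> fo (fun N v => exists x, E N v x).
Proof.
move=> fE.
apply: fo_ext (fo_not (fo_all (E := fun N v x => ~ E N v x) (fo_not fE))) => N v.
split=> [/existsNP[x /contrapT]|[x h /(_ x)//]]; by exists x.
Qed.

Lemma fo_sub D (s : forall N : structure L, (nat -> N) -> nat -> N) (f : nat -> nat) :
  fo D -> (forall N v i, s N v i = v (f i)) -> fo (fun N v => D N (s N v)).
Proof.
case=> n [phi H] e; pose m := \max_(i < n) (f i).+1.
have lt (i : 'I_n) : f i < m by apply: (leq_bigmax (F := fun i : 'I_n => (f i).+1)).
exists m, (rename phi (fun i => Ordinal (lt i))) => N v.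
rewrite sat_rename -H; suff -> : @res N n (s N v) = res v \o (fun i => Ordinal (lt i)) by [].
by apply: funext => i; rewrite /res e.
Qed.

Lemma fo_eqv i j : fo (fun (N : structure L) v => v i = v j :> N).
Proof.
apply: (fo_sub (D := fun N v => v 0 = v 1) (s := fun N v => scons (v i) (scons (v j) v))
  (f := scons i (scons j id))) => [|N v [|[|k]]//].
exists 2, (Eq (Var L (ord0 : 'I_2)) (Var L (ord_max : 'I_2))) => N v.
by [].
Qed.

Lemma fo_graph k (g : func L k) (f : 'I_k -> nat) i :
  fo (fun (N : structure L) v => v i = fun_interp g (fun j => v (f j)) :> N).
Proof.
pose m := (i + \max_(j < k) f j).+1.
have lti : i < m by rewrite ltnS leq_addr.
have lt j : f j < m by rewrite ltnS (leq_trans _ (leq_addl _ _))// (leq_bigmax (F := f)).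
by exists m, (Eq (Var L (Ordinal lti)) (App g (fun j => Var L (Ordinal (lt j))))).
Qed.

Lemma fo_rel k (R : rel_symb L k) (f : 'I_k -> nat) :
  fo (fun (N : structure L) v => rel_interp R (fun j => v (f j) : N)).
Proof.
pose m := (\max_(j < k) f j).+1.
have lt j : f j < m by rewrite ltnS (leq_bigmax (F := f)).
by exists m, (Rel R (fun j => Var L (Ordinal (lt j)))).
Qed.

End FirstOrder.

(** * Formulas of [L] inside the language of pairs *)

Section Pairs.
Variable L : language.

Fixpoint pair_term n (t : term L n) : term (pair_language L) n :=
  match t with
  | Var i => Var (pair_language L) i
  | App k g ts => @App (pair_language L) n k g (fun i => pair_term (ts i))
  end.

Fixpoint unpair_term n (t : term (pair_language L) n) : term L n :=
  match t with
  | Var i => Var L i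
  | App k g ts => @App L n k g (fun i => unpair_term (ts i))
  end.

Fixpoint pair_formula n (phi : formula L n) : formula (pair_language L) n :=
  match phi in formula _ n return formula (pair_language L) n with
  | Bot n => Bot _ n
  | Eq _ t u => Eq (pair_term t) (pair_term u)
  | Rel n k R ts => @Rel (pair_language L) n k (Old R) (fun i => pair_term (ts i))
  | Imp _ phi psi => Imp (pair_formula phi) (pair_formula psi)
  | All _ phi => All (pair_formula phi)
  end.

Lemma eval_pair (N : structure (pair_language L)) n (t : term L n) (v : 'I_n -> N) :
  eval v (pair_term t) = @eval L (reduct N) n v t.
Proof.
elim: t => //= k g ts IH.
by congr fun_interp; apply: funext => i; rewrite IH.
Qed.

Lemma eval_unpair (N : structure (pair_language L)) n (t : term (pair_language L) n)
    (v : 'I_n -> N) :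
  eval v t = @eval L (reduct N) n v (unpair_term t).
Proof.
elim: t => //= k g ts IH.
by congr fun_interp; apply: funext => i; rewrite IH.
Qed.

Lemma sat_pair (N : structure (pair_language L)) n (phi : formula L n) (v : 'I_n -> N) :
  sat (pair_formula phi) v <-> @sat L (reduct N) n phi v.
Proof.
elim: phi v => {n} [n|n t u|n k R ts|n phi IH psi IH'|n phi IH] v //=.
- by rewrite !eval_pair.
- by under eq_fun do rewrite eval_pair.
- by rewrite IH IH'.
- by split=> h x; have := h x; rewrite IH.
Qed.

Lemma fo_pair (D : forall N : structure L, (nat -> N) -> Prop) :
  fo D -> @fo (pair_language L) (fun N v => D (reduct N) v).
Proof.
case=> n [phi H]; exists n, (pair_formula phi) => N v.
by rewrite sat_pair; apply: H.
Qed.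

End Pairs.

Definition const (L : language) (N : structure L) (f : func L 0) : N :=
  fun_interp f (fun i : 'I_0 => match notF (ltn_ord i) with end).

Section Terms.
Variable L : language.

(** Definable functions, presented by their graphs; the variable 0 holds the value. *)
Definition fot (t : forall N : structure L, (nat -> N) -> N) : Prop :=
  fo (fun N v => v 0 = t N (v \o S)).

Lemma fo_subt (E : forall N : structure L, (nat -> N) -> N -> Prop) t :
  fo (fun N v => E N (fun i => v i.+1) (v 0)) -> fot t -> fo (fun N v => E N v (t N v)).
Proof.
move=> fE ft.
apply: fo_ext (fo_ex (E := fun N v x => x = t N v /\ E N v x) (fo_and ft fE)) => N v.
by split=> [[_ [->]]|]; last exists (t N v).
Qed.

Lemma fot_sub t (s : forall N : structure L, (nat -> N) -> nat -> N) (f : nat -> nat) :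
  fot t -> (forall N v i, s N v i = v (f i)) -> fot (fun N v => t N (s N v)).
Proof.
move=> ft e.
apply: (fo_sub (D := fun N v => v 0 = t N (v \o S))
  (s := fun N v => scons (v 0) (s N (v \o S))) (f := scons 0 (S \o f))) ft _.
by move=> N v [|i] //=; rewrite e.
Qed.

Lemma fot_var i : fot (fun N v => v i).
Proof. exact: fo_eqv. Qed.

Lemma fot_const (f : func L 0) : fot (fun N v => const N f).
Proof.
apply: fo_ext (fo_graph f (fun=> 0) 0) => N v; rewrite /const.
suff -> : (fun _ : 'I_0 => v 0) = (fun i : 'I_0 => match notF (ltn_ord i) with end) by [].
by apply: funext => -[].
Qed.

End Terms.

(** * Definable sets over a set of parameters *)

Section Definability.
Variables (L : language) (z0 : func L 0) (N : structure L).

(* Finitely many parameters suffice: [w] recovers the others as constants. *)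
Lemma formula_over (A : set N) D (z : nat -> N) :
  fo D -> (forall i, A (z i) \/ z i = const N z0) ->
  exists m (phi : formula L (1 + m)) (p : 'I_m -> N), exists2 w,
    forall (N' : structure L) (b : 'I_m -> N') i, range b (w N' b i) \/ w N' b i = const N' z0 &
    [/\ forall i, A (p i),
        forall (N' : structure L) (b : 'I_m -> N') x,
          sat phi (vcat (fun _ : 'I_1 => x) b) <-> D N' (scons x (w N' b)) &
        forall x, sat phi (vcat (fun _ : 'I_1 => x) p) <-> D N (scons x z)].
Proof.
move=> fD Az; have [n Hn] := fo_support fD.
(* With [A] empty no parameter is available, so the tuple must have length 0. *)
pose m := if `[< A !=set0 >] then n else 0.
pose P i := `[< A (z i) >] && (i < m).
pose c (N' : structure L) (v : nat -> N') i : N' := if P i then v i.+1 else const N' z0.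
have fD' : fo (fun N' v => D N' (scons (v 0) (c N' v))).
  apply: (fo_subt (E := fun N' v x => D N' (scons (v 0) (fun i => if P i then v i.+1 else x))));
    last exact: fot_const.
  apply: (fo_sub (f := scons 1 (fun i => if P i then i.+2 else 0))) fD _.
  by move=> N' v [|i] //=; case: ifP.
have [|phi Hphi] := fo_bounded (n := 1 + m) fD' isT.
  move=> N' v v' e; congr D; apply: funext => -[|i] /=; first by rewrite e.
  by rewrite /c; case: ifP => // /andP[_ im]; rewrite e.
have [a0 Ha0] : exists a0, A !=set0 -> A a0.
  by have [[a ?]|h] := pselect (A !=set0); [exists a|exists (z 0) => /h].
pose ext (N' : structure L) (b : 'I_m -> N') i := if insub i is Some j then b j else const N' z0.
have res_ext (N' : structure L) (b : 'I_m -> N') : res (ext N' b) = b.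
  by apply: funext => j; rewrite /res /ext valK.
(* The positions that [phi] ignores are filled with an arbitrary element of [A]. *)
pose p := @res N m (fun i => if P i then z i else a0).
exists m, phi, p; exists (fun N' b i => if P i then ext N' b i else const N' z0).
  move=> N' b i; case: ifP => [_|]; last by right.
  by rewrite /ext; case: insubP => [j _ _|_]; [left; exists j|right].
split=> [i|N' b x|x].
- rewrite /p /res; case: ifP => [/andP[/asboolP]//|_].
  by apply: Ha0; case: i => i /=; rewrite /m; case: ifP => // /asboolP.
- by rewrite -[b in vcat _ b]res_ext vcat_res Hphi.
rewrite vcat_res Hphi; set z' := c N _.
have e i : i < n -> z' i = z i.
  move=> lt; rewrite /z' /c /= /P; have [Ai /=|] := asboolP (A (z i)); last by case: (Az i).
  suff -> : i < m by [].
  by rewrite /m asboolT//; exists (z i).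
by split; apply: Hn => -[|i] //= /ltnW/e.
Qed.

Lemma tp_fo (A : set N) (x y : N) D (z : nat -> N) :
  tp A (fun _ : 'I_1 => x) = tp A (fun _ : 'I_1 => y) ->
  fo D -> (forall i, A (z i) \/ z i = const N z0) -> D N (scons x z) -> D N (scons y z).
Proof.
move=> e fD Az; have [m [phi [p [w _ [Ap _ H]]]]] := formula_over fD Az.
rewrite -!H => hx; suff: tp A (fun=> y) (PFormula phi p) by case.
by rewrite -e.
Qed.

End Definability.

Lemma aut_sat (L : language) (M : structure L) (g : M -> M) : automorphism g ->
  forall n (phi : formula L n) v, sat phi (g \o v) <-> sat phi v.
Proof.
case=> bij gf gr.
have gev n (t : term L n) v : eval (g \o v) t = g (eval v t).
  elim: t => //= k f ts IH; rewrite gf; congr fun_interp.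
  by apply: funext => i; rewrite IH.
move=> n phi; elim: phi => {n} [n|n t u|n k R ts|n phi IH psi IH'|n phi IH] v //=.
- rewrite !gev; split=> [|->//]; exact: (bij_inj bij).
- by rewrite (gr k R (fun i => eval v (ts i))); under eq_fun do rewrite gev.
- by rewrite IH IH'.
- have e x : vcat (fun _ : 'I_1 => g x) (g \o v) = g \o vcat (fun _ : 'I_1 => x) v.
    by apply: funext => i; rewrite /vcat /=; case: fintype.split.
  split=> h x; first by have := h (g x); rewrite e IH.
  by case: bij => f _ fK; rewrite -(fK x) e IH.
Qed.

Section Smallness.
Variables (L : language) (kappa : Type).
Hypothesis large : card_lt [set: {n & formula L n}] [set: kappa].

(** The formulas [Bot L n] are pairwise distinct, so [kappa] is uncountable. *)
Lemma countable_small (T : Type) (A : set T) : countable A -> small kappa A.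
Proof.
case: large => le nle cA.
have nat_le : [set: nat] #<= [set: {n & formula L n}].
  have /injfunPex[f] : exists2 f : nat -> {n & formula L n},
      set_fun setT setT f & set_inj setT f.
    by exists (fun n => existT _ n (Bot L n)) => // n m _ _ /(congr1 (fun s => tag s)).
  exact: inj_card_le f.
split; first exact: card_le_trans cA (card_le_trans nat_le le).
by move=> /card_le_trans/(_ cA)/card_le_trans/(_ nat_le).
Qed.
End Smallness.

(** * Integral domains *)

Section IntegralDomain.
Variables (D : Type) (zero one : D) (add mul : D -> D -> D) (opp : D -> D).
Hypothesis domD : is_integral_domain zero one add mul opp.
Import GRing.Theory.

(** Gives access to the [ring] tactic and to the bound on the number of roots of a polynomial.
    Inverses of units are obtained by choice. *)
Lemma idomain_structure : exists R : idomainType, exists2 f : D -> R, injective f &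
  forall x y, f (add x y) = (f x + f y)%R /\ f (mul x y) = (f x * f y)%R.
Proof.
case: domD => [[addA addC add0 addN] [mulA mulC mul1 mulDl] one0 mul_eq0].
pose D' : choiceType := HB.pack D (gen_eqMixin D) (gen_choiceMixin D).
pose zm := GRing.isZmodule.Build D' addA addC add0 addN.
have one0b : (one : D') != zero by apply/eqP.
pose Z : zmodType := HB.pack D' zm.
pose rm := GRing.Zmodule_isComNzRing.Build Z mulA mulC mul1 mulDl one0b.
pose A : comNzRingType := HB.pack Z rm.
pose unit : pred A := fun x => `[< exists y, y * x = 1 >]%R.
have invP (x : A) : exists y : A, (unit x -> y * x = 1)%R /\ (~~ unit x -> y = x).
  have [/asboolP[y xy]|nu] := boolP (unit x).
    by exists y; split=> //; rewrite /unit; case: asboolP => // -[]; exists y.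
  by exists x; split=> // ux; rewrite ux in nu.
pose inv x := sval (cid (invP x)).
have h1 : {in unit, left_inverse 1%R inv *%R} by move=> x ux; exact: (svalP (cid (invP x))).1.
have h2 (x y : A) : (y * x = 1)%R -> unit x by move=> yx; apply/asboolP; exists y.
have h3 : {in [predC unit], inv =1 id} by move=> x ux; exact: (svalP (cid (invP x))).2.
pose um := GRing.ComNzRing_hasMulInverse.Build A h1 h2 h3.
pose U : comUnitRingType := HB.pack A um.
have h4 : GRing.integral_domain_axiom U.
  by move=> x y /mul_eq0 [] ->; rewrite eqxx ?orbT.
pose im := GRing.ComUnitRing_isIntegral.Build U h4.
pose R : idomainType := HB.pack U im.
by exists R, id.
Qed.

Definition fma x c y := add x (mul c y).

(** Horner form of the polynomial with coefficients [q 0], ..., [q k], evaluated at [y]. *)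
Fixpoint horn (q : nat -> D) (y : D) (k : nat) : D :=
  if k is k'.+1 then fma (q 0) y (horn (q \o S) y k') else q 0.

Lemma fma_inj x x' c y : fma x c y = fma x' c y -> x = x'.
Proof.
have [R [f finj fE]] := idomain_structure.
by move=> /(congr1 f); rewrite !(fE _ _).1 => /addIr/finj.
Qed.

(** Subtracting the two equations gives [(c - c') (y - y') = 0]. *)
Lemma fma_slope x x' c c' y y' :
  fma x c y = fma x' c y' -> fma x c' y = fma x' c' y' -> y <> y' -> c = c'.
Proof.
have [R [f finj fE]] := idomain_structure.
move=> /(congr1 f) + /(congr1 f); rewrite !(fE _ _).1 !(fE _ _).2 => e e' ne.
apply finj; apply/eqP; rewrite -subr_eq0.
have nz : (f y - f y' != 0)%R by rewrite subr_eq0; apply/eqP => /finj.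
have : ((f c - f c') * (f y - f y') = 0)%R.
  transitivity ((f x + f c * f y - (f x' + f c * f y'))
    - (f x + f c' * f y - (f x' + f c' * f y')))%R; first by ring.
  by rewrite e e' !subrr.
by move/eqP; rewrite mulf_eq0 (negbTE nz) orbF.
Qed.

(** The difference of the two polynomials has degree at most [k] and [k + 1] distinct roots. *)
Lemma horn_inj q q' y k :
  (forall i j, i <= k -> j <= k -> y i = y j -> i = j) ->
  (forall j, j <= k -> horn q (y j) k = horn q' (y j) k) ->
  forall i, i <= k -> q i = q' i.
Proof.
have [R [f finj fE]] := idomain_structure.
move=> yinj e i ik; apply finj.
have hornE p x : f (horn p x k) = (\poly_(i < k.+1) f (p i)).[f x]%R.
  rewrite horner_poly; elim: k p {yinj e i ik} => [|k IH] p.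
    by rewrite big_ord1 expr0 mulr1.
  rewrite big_ord_recl expr0 mulr1 /= (fE _ _).1 (fE _ _).2 IH mulr_sumr.
  by congr (_ + _)%R; apply: eq_bigr => j _; rewrite exprS /=; ring.
pose P := (\poly_(i < k.+1) f (q i) - \poly_(i < k.+1) f (q' i))%R.
have P0 : P = 0%R.
  apply/eqP/negP => /negP P0.
  have := @max_poly_roots _ P [seq f (y j) | j <- iota 0 k.+1] P0.
  have -> : all (root P) [seq f (y j) | j <- iota 0 k.+1].
    apply/allP => x /mapP[j]; rewrite mem_iota add0n ltnS => jk ->.
    by rewrite /root /P hornerD hornerN -!hornE e// subrr.
  have -> : uniq [seq f (y j) | j <- iota 0 k.+1].
    rewrite map_inj_in_uniq ?iota_uniq// => i1 i2.
    by rewrite !mem_iota !add0n !ltnS => h1 h2 /finj; apply: yinj.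
  rewrite size_map size_iota => /(_ isT isT); rewrite ltnNge.
  by rewrite (leq_trans (size_polyD _ _))// size_polyN geq_max !size_poly.
have := congr1 (fun p : {poly R} => p`_i)%R P0.
by rewrite coef0 coefB !coef_poly ltnS ik => /eqP; rewrite subr_eq0 => /eqP.
Qed.

End IntegralDomain.

Lemma countable_union (U : Type) (A B : set U) :
  countable A -> countable B -> countable (A `|` B).
Proof.
move=> cA cB; rewrite -bigcup2E; apply: bigcup_countable => [|i _]; first exact: countableP.
by case: i => [|[|i]] //; exact: countable0.
Qed.

Lemma countable_range (T : Type) (z : nat -> T) : countable (range z).
Proof. exact: card_image_le. Qed.

Lemma universal_closure (L : language) n (phi : formula L n) :
  exists sigma : sentence L,
    forall N : structure L, holds N sigma <-> forall v : 'I_n -> N, sat phi v.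
Proof.
elim: n phi => [|n IH] phi; first by exists phi.
have [sigma H] := IH (All phi); exists sigma => N; rewrite H /=; split=> h v.
  have -> : v = @vcat N 1 n (fun _ : 'I_1 => v (lshift n (ord0 : 'I_1))) (fun i => v (rshift 1 i)).
    apply: funext => i; rewrite /vcat; case: (split_ordP (i : 'I_(1 + n))) => j -> //.
    by rewrite ord1.
  exact: h.
by move=> x; apply: h.
Qed.

(** * Genericity as a first-order property *)

Section Ring.
Variables (L : language) (S : ring_symbols L).

Definition op2 (N : structure L) (f : func L 2) (x y : N) : N :=
  fun_interp f (fun i : 'I_2 => if i == ord0 then x else y).

Definition zer (N : structure L) : N := const N (rs_zero S).
Definition lin (N : structure L) : N -> N -> N -> N :=
  fma (op2 (rs_add S)) (op2 (rs_mul S)).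
Definition hor (N : structure L) : (nat -> N) -> N -> nat -> N :=
  horn (op2 (rs_add S)) (op2 (rs_mul S)).

Lemma fot_op2 f (t u : forall N : structure L, (nat -> N) -> N) :
  fot t -> fot u -> fot (fun N v => op2 f (t N v) (u N v)).
Proof.
move=> ft fu.
apply: (fo_subt (E := fun N v x => v 0 = op2 f x (u N (v \o succn)))); last first.
  by apply: (fot_sub (s := fun N v => v \o succn) (f := succn)) ft _.
apply: (fo_subt (E := fun N v x => v 1 = op2 f (v 0) x)); last first.
  by apply: (fot_sub (s := fun N v => fun i => v i.+2) (f := fun i => i.+2)) fu _.
apply: fo_ext (fo_graph f (fun i : 'I_2 => if i == ord0 then 1 else 0) 2) => N v.
suff -> : (fun j : 'I_2 => v (if j == ord0 then 1 else 0)) =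
  (fun j : 'I_2 => if j == ord0 then v 1 else v 0) by [].
by apply: funext => i; case: ifP.
Qed.

Lemma fot_lin (t u w : forall N : structure L, (nat -> N) -> N) :
  fot t -> fot u -> fot w -> fot (fun N v => lin (t N v) (u N v) (w N v)).
Proof. by move=> ft fu fw; do 2 apply: fot_op2 => //. Qed.

Lemma fot_hor k (q : forall N : structure L, (nat -> N) -> nat -> N)
    (y : forall N : structure L, (nat -> N) -> N) :
  (forall i, fot (fun N v => q N v i)) -> fot y ->
  fot (fun N v => hor (q N v) (y N v) k).
Proof.
move=> fq fy; elim: k q fq => [|k IH] q fq; first exact: fq.
apply: fot_lin => //; apply: (IH (fun N v => q N v \o succn)) => i; exact: fq.
Qed.

(* Holds iff [D] does at the elements generic over [z], see [genP]. *)
Definition gen (D : forall N : structure L, (nat -> N) -> Prop)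
    (N : structure L) (z : nat -> N) : Prop :=
  forall c, exists x1 x2 x3 x4,
    [/\ D N (scons x1 z) /\ D N (scons x2 z), D N (scons x3 z) /\ D N (scons x4 z),
        ~ (x1 = x3 /\ x2 = x4) & lin x1 c x2 = lin x3 c x4].

Lemma fo_gen (D : forall N : structure L, (nat -> N) -> Prop) : fo D -> fo (gen D).
Proof.
move=> fD; rewrite /gen.
have fDi i : fo (fun (N : structure L) v => D N (scons (v i) (fun k => v (5 + k)))).
  by apply: (fo_sub (f := scons i (fun k => 5 + k))) fD _ => N v [|j].
apply: fo_all; do 4 apply: fo_ex.
have fl : fo (fun (N : structure L) v => lin (v 3) (v 4) (v 2) = lin (v 1) (v 4) (v 0)).
  apply: (fo_subt (E := fun N v x => lin (v 3) (v 4) (v 2) = x));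
    last by apply: fot_lin; apply: fot_var.
  apply: fo_ext (fot_lin (fot_var L 3) (fot_var L 4) (fot_var L 2)) => N v.
  by split=> ->.
apply: fo_ext (fo_and (fo_and (fDi 3) (fDi 2)) (fo_and (fo_and (fDi 1) (fDi 0))
  (fo_and (fo_not (fo_and (fo_eqv L 3 1) (fo_eqv L 2 0))) fl))) => N v.
by split=> [[? [? [? ?]]]|[? ? ? ?]].
Qed.

End Ring.

(** * Ranks, types and matroids *)

Lemma rank1P (M : Type) (cl : set M -> set M) (A : set M) (b : 'I_1 -> M) :
  rk cl A b = 1 <-> ~ cl A (b ord0).
Proof.
have e (I : {set 'I_1}) : A `|` [set b j | j in [set j | j \in I :\ ord0]] = A.
  by apply/seteqP; split=> [x [//|[j /=]]|x]; [rewrite ord1 !inE|left].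
split=> [rk1|ncl].
  have [I /asboolP indI cI] : exists2 I : {set 'I_1}, `[< independent cl A b I >] & #|I| = 1.
    have i0 : `[< independent cl A b finset.set0 >] by apply/asboolP => i; rewrite inE.
    have [I ? eI] := @eq_bigmax_cond _ [pred I : {set 'I_1} | `[< independent cl A b I >]]
      (fun I => #|I|) (ltac:(by apply/card_gt0P; exists finset.set0)).
    by exists I => //; rewrite -eI -[RHS]rk1.
  have /cards1P[i Ii] := introT eqP cI.
  by have := indI ord0; rewrite e Ii; apply; rewrite ord1 inE.
apply/eqP; rewrite eqn_leq; apply/andP; split.
  apply/bigmax_leqP => I _; rewrite -[leqRHS](card_ord 1); exact: max_card.
have := @leq_bigmax_cond _ (fun I : {set 'I_1} => `[< independent cl A b I >])
  (fun I => #|I|) [set ord0]%SET; rewrite cards1; apply.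
by apply/asboolP => i; rewrite ord1 => _; rewrite e.
Qed.

Lemma rank1_le (M : Type) (cl : set M -> set M) (A : set M) (b : 'I_1 -> M) :
  rk cl A b <= 1.
Proof.
apply/bigmax_leqP => I _; rewrite -[leqRHS](card_ord 1); exact: max_card.
Qed.

(** The upper bound in [has_dim] is automatic for 1-tuples, so only a point of rank 1 is
    required. *)
Lemma has_dim1P (M : Type) (cl : set M -> set M) (A : set M) (V : set ('I_1 -> M)) :
  has_dim cl A V 1 <-> exists2 b, V b & ~ cl A (b ord0).
Proof.
split=> [[[b Vb rkb] _]|[b Vb ncl]]; first by exists b => //; exact: (iffLR (rank1P cl A b) rkb).
by split=> [|*]; [exists b => //; exact/rank1P|exact: rank1_le].
Qed.

Lemma complete_tp (L : language) (M : structure L) (A : set M) n (v : 'I_n -> M) :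
  complete_type A (tp A v).
Proof.
split=> [phi []//|s _ sub|phi Aphi]; first by exists v => phi /sub[].
by have [?|?] := pselect (psat phi v); [left|right].
Qed.

Lemma complete_type_tp (L : language) (M : structure L) (A : set M) n p (v : 'I_n -> M) :
  complete_type A p -> realizations p v -> p = tp A v.
Proof.
move=> [sub _ dec] pv; apply/seteqP; split=> [phi pphi|phi [Aphi sphi]].
  by split; [exact: sub|exact: pv].
by have [//|/pv h] := dec phi Aphi; case: (h sphi).
Qed.

Section Matroid.
Variables (M : Type) (cl : set M -> set M).
Hypothesis matcl : matroid cl.

Lemma mat_sub X : X `<=` cl X. Proof. by case: matcl. Qed.

Lemma mat_mono X Y : X `<=` Y -> cl X `<=` cl Y.
Proof. by case: matcl => _ h _ _ _; apply: h. Qed.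

Lemma mat_trans X Y : X `<=` cl Y -> cl X `<=` cl Y.
Proof. by case: matcl => _ mono idem _ _ /mono; rewrite idem. Qed.

Lemma mat_exch X a c : cl (X `|` [set c]) a -> ~ cl X a -> cl (X `|` [set a]) c.
Proof. by case: matcl => _ _ _ _ ex ha na; apply: ex. Qed.

(* Steinitz exchange. *)
Lemma mat_steinitz X (p q : nat -> M) k :
  (forall i, i <= k -> cl (X `|` p @` `I_k) (q i)) ->
  exists2 i, i <= k & cl (X `|` q @` `I_i) (q i).
Proof.
elim: k X p q => [|k IH] X p q h.
  by exists 0 => //; have := h 0 isT; rewrite !II0 !image_set0.
have [q0|nq0] := pselect (cl X (q 0)).
  by exists 0 => //; rewrite II0 image_set0 setU0.
(* [p j] is the first generator whose addition captures [q 0]. By exchange [q 0] can replace it. *)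
have [j [jk ncl incl]] : exists j, [/\ j < k.+1, ~ cl (X `|` p @` `I_j) (q 0)
    & cl (X `|` p @` `I_j.+1) (q 0)].
  have := h 0 isT; elim: k.+1 => [|m IHm].
    by rewrite II0 image_set0 setU0 => /nq0.
  have [/IHm[j [jm ? ?]] _|? ?] := pselect (cl (X `|` p @` `I_m) (q 0)).
    by exists j; split=> //; apply: leq_trans jm _.
  by exists m.
have pj : cl (X `|` p @` `I_j `|` [set q 0]) (p j).
  apply: mat_exch ncl; apply: mat_mono incl => x [?|[i /=]]; first by do 2 left.
  rewrite ltnS leq_eqVlt => /orP[/eqP->|ij] <-; first by right.
  by left; right; exists i.
(* [bump j] skips the index [j]: this is [p] without [p j]. *)
pose p' i := p (bump j i).
have [|i ik hi] := IH (X `|` [set q 0]) p' (q \o S).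
  move=> i ik; apply: (mat_trans _ (h i.+1 ik)) => x [Xx|[m /= mk <-]].
    by apply: mat_sub; left; left.
  have [mj|jm|->] := ltngtP m j.
  - apply: mat_sub; right; exists m => /=; last by rewrite /p' /bump leqNgt mj.
    exact: leq_trans mj jk.
  - apply: mat_sub; right; exists m.-1 => /=; first by case: m jm mk.
    by rewrite /p' /bump -ltnS (ltn_predK jm) jm add1n (ltn_predK jm).
  apply: mat_mono pj => y [[Xy|[m' /= mj' <-]]|->]; [by left; left| |by left; right].
  right; exists m' => /=; first exact: leq_trans mj' jk.
  by rewrite /p' /bump leqNgt mj'.
exists i.+1 => //; apply: mat_mono hi => x [[Xx|->]|[m /= mi <-]]; first by left.
- by right; exists 0.
- by right; exists m.+1.
Qed.

End Matroid.

(** * Saturation *)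

Lemma filter_finite (I U : Type) (F : set_system U) (s : set I) (f : I -> set U) :
  Filter F -> finite_set s -> (forall i, s i -> F (f i)) ->
  F [set y | forall i, s i -> f i y].
Proof.
elim/Pchoice: I => I in s f *.
move=> FF /finite_seqP[l ->]; elim: l => [|i l IH] Fl.
  by apply: filterS filterT => y _ i.
have Fi : F (f i) by apply: Fl; rewrite /= mem_head.
have {}IH : F [set y | forall j, [set` l] j -> f j y].
  by apply: IH => j lj; apply: Fl; rewrite /= inE lj orbT.
apply: filterS (filterI Fi IH) => y [yi yl] j /=.
by rewrite inE => /orP[/eqP->//|]; apply: yl.
Qed.

(* An ultrafilter containing the complements of the members of [I] gives a complete type. *)
Lemma saturated_ideal (L : language) (c : func L 0) (kappa : Type) (N : structure L)
    (A : set N) (I : set (set N)) :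
  saturated kappa N -> small kappa A ->
  (forall Y Z, I Y -> I Z -> I (Y `|` Z)) -> (forall Y Z, Y `<=` Z -> I Z -> I Y) ->
  I set0 -> ~ I setT ->
  exists x, forall D (z : nat -> N), fo D -> (forall i, A (z i) \/ z i = const N c) ->
    I [set y | D N (scons y z)] -> ~ D N (scons x z).
Proof.
move=> satN sA IU IS I0 IT; pose F := [set Y | I (~` Y)].
have FF : ProperFilter F.
  split; first by rewrite /F /= setC0.
  split; first by rewrite /F /= setCT.
    by move=> Y Z IY IZ; rewrite /F /= setCI; exact: IU.
  by move=> Y Z YZ; apply: IS; exact: subsetC.
have [U [UU FU]] := ultraFilterLemma FF.
pose p : set (pformula N 1) := [set psi | Defs.over A psi /\ U [set y | psat psi (fun=> y)]].
have cp : complete_type A p.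
  split=> [psi []//|s fs sp|psi Apsi].
    have /filter_ex[y h] : U [set y | forall psi, s psi -> psat psi (fun=> y)].
      by apply: filter_finite => // psi /sp[].
    by exists (fun=> y).
  have [?|?] := in_ultra_setVsetC [set y | psat psi (fun=> y)] UU; first by left.
  by right.
have [v pv] := satN A sA 1 p cp.
exists (v ord0) => D z fD Az ID.
have [m [phi [b [w _ [Ab _ H]]]]] := formula_over (fo_not fD) Az.
suff /pv : p (PFormula phi b).
  rewrite /psat /= (_ : v = fun=> v ord0) ?H//.
  by apply: funext => i; rewrite ord1.
split=> //; apply: FU; apply: IS ID => y /= nsat; apply: contrapT => nD.
by apply: nsat; rewrite /psat /=; apply/H.
Qed.

(* Only finitely many entries of [w] matter; the default value makes the others harmless. *)
Lemma fo_ex_env (L : language) (c : func L 0) (Q : forall N : structure L, N -> Prop)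
    (D : forall N : structure L, (nat -> N) -> Prop) :
  fo (fun N v => Q N (v 0)) -> fo D ->
  fo (fun N v => exists w, (forall i, Q N (w i) \/ w i = const N c) /\ D N (mix w v)).
Proof.
move=> fQ fD; have [n Hn] := fo_support fD.
(* [E k] quantifies only over sequences that are constant from index [k] on. The support of [D]
   reduces the claim to [E n], and each induction step trades one entry of [w] for an ordinary
   quantifier. *)
pose E k (D : forall N : structure L, (nat -> N) -> Prop) (N : structure L) v :=
  exists w, [/\ forall i, Q N (w i) \/ w i = const N c,
    forall i, k <= i -> w i = const N c & D N (mix w v)].
suff : fo (E n D).
  apply: fo_ext => N v; split=> [[w [? _ ?]]|[w [Qw Dw]]]; first by exists w.
  exists (fun i => if i < n then w i else const N c); split=> [i|i|].
  - by case: ifP => _; [exact: Qw|right].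
  - by rewrite leqNgt => /negbTE->.
  apply: Hn Dw => i lt; rewrite /mix; case: odd => //.
  by rewrite (leq_ltn_trans _ lt)// leq_half_double -addnn -addnS leq_addr.
elim: n D {Hn} fD => [|k IH] D fD.
  apply: (fo_ext (D := fun N v => D N (mix (fun=> const N c) v))) => [N v|].
    split=> [h|[w [_ w0]]]; first by exists (fun=> const N c); split=> // i; right.
    by rewrite (_ : w = fun=> const N c)//; apply: funext => i; exact: w0.
  apply: (fo_subt (E := fun N v x => D N (mix (fun=> x) v))); last exact: fot_const.
  apply: (fo_sub (f := mix (fun=> 0) succn)) fD _ => N v i.
  by rewrite /mix; case: odd.
(* [D1] reads the first entry of [w] at the head of the parameters instead. *)
pose D1 (N : structure L) (u : nat -> N) :=
  D N (mix (scons (u 1) (fun i => u i.*2)) (fun i => u i.*2.+3)).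
have fD1 : fo D1.
  apply: (fo_sub (f := mix (scons 1 double) (fun i => i.*2.+3))) fD _ => N v i.
  by rewrite /mix; case: odd => //; case: i./2.
have D1E (N : structure L) (w v : nat -> N) x : D1 N (mix w (scons x v)) = D N (mix (scons x w) v).
  congr D; congr mix; last exact: (congr1 (fun f => f \o succn) (mix_odd w (scons x v))).
  by congr scons; exact: mix_even.
apply: (fo_ext (D := fun N v => exists x, (Q N x \/ x = const N c) /\ E k D1 N (scons x v))).
  move=> N v; split=> [[x [Qx [w [Qw w0]]]]|[w [Qw w0 Dw]]].
    rewrite D1E => Dw; exists (scons x w).
    by split=> [[|i]|[|i] //|//]; [exact: Qx|exact: Qw|exact: w0].
  exists (w 0); split; first exact: Qw.
  exists (w \o succn); split=> [i|i ki|]; [exact: Qw|exact: w0|].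
  by rewrite D1E sconsE.
apply: fo_ex; apply: fo_and.
  apply: fo_or => //; exact: fot_const.
by apply: fo_ext (IH _ fD1) => N v; rewrite sconsE.
Qed.

(** * Generic elements of the monster model *)

Section Existential.
Variables (L : language) (S : ring_symbols L) (T : theory L).
Hypothesis T_complete : complete T.
Hypothesis T_domains : expands_integral_domains S T.
Variables (kappa : Type) (M : structure L).
Hypotheses (M_models : models M T) (M_monster : monster kappa M).
Variable cl : set M -> set M.
Hypothesis cl_existential : existential_matroid kappa cl.
Hypothesis T_minimal : cl_minimal kappa cl.

Implicit Types D chi : forall N : structure L, (nat -> N) -> Prop.

Local Notation zer := (zer S).
Local Notation lin := (lin S).
Local Notation hor := (hor S).
Local Notation gen := (gen S).

Lemma matroid_cl : matroid cl. Proof. by case: cl_existential. Qed.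

Lemma small_countable (U : Type) (A : set U) : countable A -> small kappa A.
Proof. by case: M_monster => large _ _; apply: (countable_small large). Qed.

Lemma cl_extend (A B : set M) a : countable A -> countable B -> ~ cl A a ->
  exists2 a', tp A (fun _ : 'I_1 => a') = tp A (fun _ : 'I_1 => a) & ~ cl (A `|` B) a'.
Proof.
case: cl_existential => _ _ ex _ cA cB na.
by have [a' [? ?]] := ex a A B (small_countable cA) (small_countable cB) na; exists a'.
Qed.

(** All entries of a tuple that equal [a] are merged into one variable, so that equality of 1-types
    over [A] applies to the tuple. *)
Lemma elementary_on_swap (A : set M) a a' :
  ~ A a -> tp A (fun _ : 'I_1 => a') = tp A (fun _ : 'I_1 => a) ->
  elementary_on (A `|` [set a]) (fun x => if pselect (x = a) then a' else x).
Proof.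
move=> nAa e n phi v Av; set f := fun x => _.
pose P (i : nat) := `[< exists2 j : 'I_n, val j = i & v j = a >].
pose z i := if insub i is Some j then if P i then zer M else v j else zer M.
pose D (N : structure L) (w : nat -> N) := sat phi (res (fun i => if P i then w 0 else w i.+1)).
have fD : fo D.
  apply: (fo_sub (s := fun N w i => if P i then w 0 else w i.+1)
    (f := fun i => if P i then 0 else i.+1)) (fo_sat phi) _.
  by move=> N w i; case: ifP.
have Az i : A (z i) \/ z i = zer M.
  rewrite /z; case: insubP => [j _ ji|_]; last by right.
  case: ifP => [_|/asboolP Pi]; first by right.
  by left; have [//|eja] := Av j; case: Pi; exists j.
have Pj (j : 'I_n) : P j = `[< v j = a >].
  by apply/asboolP/asboolP => [[j' /val_inj->]|]; last exists j.
have e1 : sat phi v <-> D M (scons a z).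
  rewrite /D; suff -> : v = res (fun i => if P i then scons a z 0 else scons a z i.+1) by [].
  by apply: funext => j; rewrite /res /= /z Pj valK; case: asboolP.
have e2 : sat phi (f \o v) <-> D M (scons a' z).
  rewrite /D; suff -> : f \o v = res (fun i => if P i then scons a' z 0 else scons a' z i.+1) by [].
  apply: funext => j; rewrite /res /= /z /f Pj valK.
  by case: pselect => ?; case: asboolP.
rewrite e1 e2; split; [exact: tp_fo (esym e) fD Az|exact: tp_fo e fD Az].
Qed.

(* Otherwise Existence and homogeneity give an automorphism over [A] that moves [a]. *)
Lemma cl_of_fixed (A : set M) a : countable A ->
  (forall g, automorphism g -> (forall x, A x -> g x = x) -> g a = a) -> cl A a.
Proof.
move=> cA fix_a; apply: contrapT => na.
have [a' ea' na'] := cl_extend cA (countable1 a) na.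
have hom : strongly_homogeneous kappa M by case: M_monster.
have nAa : ~ A a by move=> /(mat_sub matroid_cl).
have sA : small kappa (A `|` [set a]).
  exact/small_countable/countable_union/countable1.
have [g ag gE] := hom _ _ sA (elementary_on_swap nAa ea').
apply: na'; apply: (mat_sub matroid_cl); right => /=.
have := gE a (or_intror erefl); case: pselect => //= _ <-.
apply: fix_a => // x Ax; rewrite gE; last by left.
by case: pselect => // xa; case: nAa; rewrite -xa.
Qed.

Lemma aut_lin (g : M -> M) x c y : automorphism g -> g (lin x c y) = lin (g x) (g c) (g y).
Proof.
case=> _ gf _; rewrite /lin /fma /op2 !gf; congr fun_interp; apply: funext => i /=.
by case: ifP => // _; rewrite gf; congr fun_interp; apply: funext => j /=; case: ifP.
Qed.

Lemma aut_zer (g : M -> M) : automorphism g -> g (zer M) = zer M.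
Proof.
by case=> _ gf _; rewrite /zer /const gf; congr fun_interp; apply: funext => -[].
Qed.

Lemma aut_hor (g : M -> M) q y k : automorphism g -> g (hor q y k) = hor (g \o q) (g y) k.
Proof.
move=> ag; elim: k q => //= k IH q.
by rewrite /hor /= -/(lin _ _ _) aut_lin// IH.
Qed.

Lemma cl_zer X : cl X (zer M).
Proof.
apply: (mat_mono matroid_cl (sub0set X)); apply: cl_of_fixed => [|g ag _].
  exact: countable0.
exact: aut_zer.
Qed.

(** Nontriviality gives an element outside the closure of the empty set; Existence moves it outside
    [cl B]. *)
Lemma cl_proper (B : set M) : countable B -> exists a, ~ cl B a.
Proof.
move=> cB; have [_ _ _ nt] := cl_existential.
have [X [a na]] : exists X a, ~ cl X a.
  apply: contrapT => h; apply: nt; apply: funext => X; apply/seteqP; split=> // a _.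
  by apply: contrapT => na; apply: h; exists X, a.
have na0 : ~ cl set0 a by move=> /(mat_mono matroid_cl (sub0set X)).
have [a' _] := cl_extend (@countable0 _) cB na0.
by rewrite set0U; exists a'.
Qed.


(** Realize the type of [a] by [a1] and [a2], independent over [B] and [c]. If no other pair in [D]
    had the same value [s] of [lin], automorphisms fixing [B], [c], [s] would fix [a1] and [a2].
    Exchange then puts [s], and with it [a2], in the closure of [B], [c], [a1]. *)
Lemma gen_cl D (z : nat -> M) a : fo D -> ~ cl (range z) a -> D M (scons a z) -> gen D z.
Proof.
move=> fD na Da c; set B := range z in na *.
have cB : countable B by exact: countable_range.
have [a1 e1 n1] := cl_extend cB (countable1 c) na.
have [a2 e2 n2] := cl_extend cB (finite_set_countable (finite_set2 c a1)) na.
apply: contrapT => noex.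
have Bz i : B (z i) \/ z i = zer M by left; exists i.
have D1 : D M (scons a1 z) by exact: tp_fo (esym e1) fD Bz Da.
have D2 : D M (scons a2 z) by exact: tp_fo (esym e2) fD Bz Da.
have inj x y : D M (scons x z) -> D M (scons y z) -> lin a1 c a2 = lin x c y ->
    a1 = x /\ a2 = y.
  move=> Dx Dy e; apply: contrapT => ne; apply: noex.
  by exists a1, a2, x, y.
pose C := B `|` [set c; lin a1 c a2].
have cC : countable C.
  by apply: countable_union => //; exact/finite_set_countable/finite_set2.
have gfix g : automorphism g -> (forall x, C x -> g x = x) -> g a1 = a1 /\ g a2 = a2.
  move=> ag gC; suff [<- <-] : a1 = g a1 /\ a2 = g a2 by [].
  have gz : g \o z = z by apply: funext => i; apply: gC; left; exists i.
  have Dg x : D M (scons x z) -> D M (scons (g x) z).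
    case: (fD) => n [phi H]; rewrite -!H -[in z in scons (g x) z]gz -comp_scons.
    by rewrite -(aut_sat ag).
  apply: inj; [exact: Dg|exact: Dg|].
  rewrite -[RHS](_ : g (lin a1 c a2) = _); first by rewrite gC//; right; right.
  by rewrite aut_lin// (gC c)//; right; left.
have c1 : cl C a1 by apply: cl_of_fixed => // g ag /(gfix g ag)[].
have c2 : cl C a2 by apply: cl_of_fixed => // g ag /(gfix g ag)[].
have sz : cl (B `|` [set c] `|` [set a1]) (lin a1 c a2).
  apply: (mat_exch matroid_cl) n1; rewrite -setUA; exact: c1.
apply: n2; apply: (mat_trans matroid_cl) c2 => x [Bx|[->|->]].
- by apply: (mat_sub matroid_cl); left.
- by apply: (mat_sub matroid_cl); right; left.
- by apply: (mat_mono matroid_cl) sz; rewrite -setUA.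
Qed.

(** Choose [c] outside the closure of [z]. A collision determines [c] from its four points, so these
    cannot all lie in that closure. *)
Lemma cl_gen D (z : nat -> M) : gen D z ->
  exists2 a, D M (scons a z) & ~ cl (range z) a.
Proof.
move=> gD; apply: contrapT => noex.
have [c nc] := cl_proper (countable_range z).
have [x1 [x2 [x3 [x4 [[D1 D2] [D3 D4] ne e]]]]] := gD c.
have Dcl x : D M (scons x z) -> cl (range z) x.
  by move=> Dx; apply: contrapT => nx; apply: noex; exists x.
apply: nc; pose C := [set x1; x2] `|` [set x3; x4].
have sC : C `<=` cl (range z) by move=> x [[]->|[]->]; apply: Dcl.
apply: (mat_trans matroid_cl sC); apply: cl_of_fixed.
  by apply: countable_union; exact/finite_set_countable/finite_set2.
move=> g ag gC.
have [g1 g2] : g x1 = x1 /\ g x2 = x2 by split; apply: gC; left; [left|right].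
have [g3 g4] : g x3 = x3 /\ g x4 = x4 by split; apply: gC; right; [left|right].
have e' : lin x1 (g c) x2 = lin x3 (g c) x4.
  by have := congr1 g e; rewrite !aut_lin// g1 g2 g3 g4.
apply: (fma_slope (T_domains M_models) e' e) => x24; apply: ne; split=> //.
by move: e'; rewrite x24; exact: (fma_inj (T_domains M_models)).
Qed.

Lemma tp_unique (B : set M) a a' : countable B -> ~ cl B a -> ~ cl B a' ->
  tp B (fun _ : 'I_1 => a) = tp B (fun _ : 'I_1 => a').
Proof.
move=> cB na na'; have [p [_ up]] := T_minimal (small_countable cB).
have gtp b : ~ cl B b -> p = tp B (fun _ : 'I_1 => b).
  move=> nb; apply: up; split; first exact: complete_tp.
  by apply/has_dim1P; exists (fun=> b) => // phi [].
by rewrite -(gtp a)// -(gtp a').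
Qed.

Lemma genP D (z : nat -> M) a : fo D -> ~ cl (range z) a ->
  D M (scons a z) <-> gen D z.
Proof.
move=> fD na; split=> [|gD]; first exact: gen_cl.
have [b Db nb] := cl_gen gD.
apply: (tp_fo (z0 := rs_zero S) (tp_unique (countable_range z) nb na) fD _ Db) => i.
by left; exists i.
Qed.

(** * The closure operator in arbitrary structures *)

(* Narrowness for relations on sequences; the variable 0 is the narrow one. *)
Definition nrw chi := forall (a : M) (z : nat -> M), chi M (scons a z) -> cl (range z) a.

(* The operator [transfer cl] (see [transferE]); the constant 0 serves as a harmless default for
   missing entries of the sequence of coefficients. *)
Definition tcl (K : structure L) (X : set K) : set K :=
  [set a | exists chi, [/\ fo chi, nrw chi &
     exists2 z, (forall i, X (z i) \/ z i = zer K) & chi K (scons a z)]].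

(** Completeness of [T] decides the universal closure of the defining formula. *)
Lemma fo_transfer D : fo D -> (forall v, D M v) ->
  forall K : structure L, models K T -> forall v, D K v.
Proof.
move=> [n [phi H]] DM K KT v; rewrite -H.
have [sigma Hs] := universal_closure phi.
have Ms : holds M sigma.
  apply/Hs => w; have -> : w = res (fun i => if insub i is Some j then w j else zer M).
    by apply: funext => j; rewrite /res valK.
  exact/H.
have [_ dec] := T_complete; have [/(_ K KT)/Hs//|] := dec sigma.
move=> /(_ M M_models); pose e := (fun i : 'I_0 => match notF (ltn_ord i) with end) : 'I_0 -> M.
by move=> /(_ e) /(_ (Ms e)).
Qed.

Lemma cl_avoid D (z : nat -> M) (C : set M) : countable C -> range z `<=` C ->
  fo D -> gen D z -> exists2 y, D M (scons y z) & ~ cl C y.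
Proof.
move=> cC zC fD gD; have [y ny] := cl_proper cC.
exists y => //; apply/(genP fD) => //.
by move=> /(mat_mono matroid_cl zC).
Qed.

(** Isolates one coefficient: every occurrence of [c] in [z] is redirected by [f] to the variable
    0. *)
Lemma split_env (U : Type) (X : set U) (c d : U) (z : nat -> U) :
  (forall i, (X `|` [set c]) (z i) \/ z i = d) ->
  exists f z', (forall i, X (z' i) \/ z' i = d) /\ z = scons c z' \o f.
Proof.
move=> Xz; exists (fun i => if `[< z i = c >] then 0 else i.+1).
exists (fun i => if `[< z i = c >] then d else z i); split=> [i|].
  by case: asboolP => zc; [right|case: (Xz i) => [[]|] //; [left|right]].
by apply: funext => i /=; case: asboolP => //= ?; case: asboolP.
Qed.

(** * The transferred operator is a matroid *)

Section Closure.
Variable K : structure L.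
Implicit Types X Y : set K.

Lemma tclI chi a (z : nat -> K) : fo chi -> nrw chi -> chi K (scons a z) -> tcl (range z) a.
Proof. by move=> ? ? ?; exists chi; split=> //; exists z => // i; left; exists i. Qed.

Lemma tcl_sub X : X `<=` tcl X.
Proof.
move=> a Xa; exists (fun N v => v 0 = v 1); split; first exact: fo_eqv.
  by move=> x z /= ->; apply: (mat_sub matroid_cl); exists 0.
by exists (fun=> a) => // _; left.
Qed.

Lemma tcl_mono X Y : X `<=` Y -> tcl X `<=` tcl Y.
Proof.
move=> XY a [chi [f n [z Xz h]]]; exists chi; split=> //; exists z => // i.
by case: (Xz i) => [/XY|]; [left|right].
Qed.

Lemma tcl_zer X : tcl X (zer K).
Proof.
exists (fun N v => v 0 = zer N); split.
- exact: fot_const.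
- by move=> a z /= ->; apply: cl_zer.
- by exists (fun=> zer K) => // _; right.
Qed.

(** The coefficient [c] is quantified existentially inside the narrow relation [th] that it
    satisfies; transitivity of [cl] in [M] keeps the result narrow. *)
Lemma tcl_cut X c a : tcl (X `|` [set c]) a -> tcl X c -> tcl X a.
Proof.
move=> [chi [fchi nchi [z Xz chia]]] [th [fth nth [w Xw thc]]].
have [f [z' [Xz' ez]]] := split_env Xz; rewrite {}ez in chia.
exists (fun N v => exists y, th N (scons y (fun i => v i.*2.+2)) /\
  chi N (scons (v 0) (scons y (fun i => v i.*2.+1) \o f))); split.
- apply: fo_ex; apply: fo_and.
    by apply: (fo_sub (f := scons 0 (fun i => i.*2.+3))) fth _ => N v [].
  apply: (fo_sub (f := scons 1 (scons 0 (fun i => i.*2.+2) \o f))) fchi _ => N v [|i] //=.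
  by case: (f i).
- move=> b v [y [/nth hy /nchi]]; apply: (mat_trans matroid_cl) => _ [i _ <-] /=.
  case: (f i) => [|j] /=.
    by apply: (mat_mono matroid_cl) hy => _ [j _ <-] /=; eexists.
  by apply: (mat_sub matroid_cl); eexists.
exists (mix z' w).
  by move=> i; rewrite /mix; case: odd.
exists c; split.
  suff -> : (fun i => scons a (mix z' w) i.*2.+2) = w by [].
  exact: (mix_odd z' w).
suff -> : (fun i => scons a (mix z' w) i.*2.+1) = z' by [].
exact: (mix_even z' w).
Qed.

Lemma tcl_fin X a : tcl X a -> exists n (z : nat -> K),
  (forall i, X (z i) \/ z i = zer K) /\ tcl (z @` `I_n) a.
Proof.
move=> [chi [fchi nchi [z Xz chia]]]; have [n Hn] := fo_support fchi.
exists n, z; split=> //; exists chi; split=> //.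
exists (fun i => if i < n then z i else zer K).
  by move=> i; case: ifP => lt; [left; exists i|right].
by apply: Hn chia => -[|i] //= /ltnW ->.
Qed.

Lemma tcl_trans X Y : X `<=` tcl Y -> tcl X `<=` tcl Y.
Proof.
move=> XY a /tcl_fin[n [z [Xz]]].
have zY i : tcl Y (z i) by case: (Xz i) => [/XY//|->]; exact: tcl_zer.
move=> /(tcl_mono (@subsetUr _ Y _)); elim: n => [|n IH].
  by rewrite II0 image_set0 setU0.
move=> h; apply: IH; apply: (tcl_cut (c := z n)); last exact: tcl_mono (zY n).
apply: tcl_mono h => x [Yx|[i /=]]; first by left; left.
by rewrite ltnS leq_eqVlt => /orP[/eqP->|lt] <-; [right|left; right; exists i].
Qed.

(** The complement of a large set contains no generic element, by [genP]. *)
Lemma nrw_gen D : fo D ->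
  let chi N v := ~ D N v /\ gen D (v \o succn) in fo chi /\ nrw chi.
Proof.
move=> fD chi; split.
  apply: fo_and; first exact: fo_not.
  exact: (fo_sub (s := fun N v => v \o succn) (f := succn) (fo_gen S fD)).
by move=> x w [Dx gD]; apply: contrapT => nx; apply: Dx; apply/(genP fD nx).
Qed.

(** By [genP] in [M], each direction can fail only at solutions of a narrow relation. *)
Lemma tcl_genP D (z : nat -> K) a : fo D -> ~ tcl (range z) a ->
  D K (scons a z) <-> gen D z.
Proof.
move=> fD na; split=> h; apply: contrapT => nh; apply: na.
- apply: (tclI (chi := fun N v => D N v /\ ~ gen D (v \o succn))) => //.
    apply: fo_and => //; apply: fo_not.
    exact: (fo_sub (s := fun N v => v \o succn) (f := succn) (fo_gen S fD)).
  move=> x w [Dx]; apply: contra_notP => nx.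
  exact/(genP fD nx).
- have [fchi nchi] := nrw_gen fD.
  exact: (tclI fchi nchi).
Qed.

(** If [c] were generic over [X] and [a], then [a] would satisfy [gen D], which does not mention [c]
    and is narrow by exchange in [M]. *)
Lemma tcl_exch X a c : tcl (X `|` [set c]) a -> ~ tcl X a -> tcl (X `|` [set a]) c.
Proof.
move=> [chi [fchi nchi [z Xz chia]]] na; apply: contrapT => nc.
have [f [z' [Xz' ez]]] := split_env Xz; rewrite {}ez in chia.
pose D (N : structure L) (v : nat -> N) :=
  chi N (scons (v 1) (scons (v 0) (fun i => v i.+2) \o f)).
have fD : fo D.
  apply: (fo_sub (f := scons 1 (scons 0 (fun i => i.+2) \o f))) fchi _ => N v [|i] //=.
  by case: (f i).
have nc' : ~ tcl (range (scons a z')) c.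
  apply: contra_not nc; apply: tcl_trans; rewrite range_scons => x [[i _ <-]|->].
    by case: (Xz' i) => [Xi|->]; [apply: tcl_sub; left|exact: tcl_zer].
  by apply: tcl_sub; right.
have gD : gen D (scons a z') by apply/(tcl_genP fD nc').
apply: na; exists (gen D); split; [exact: fo_gen| |by exists z'].
move=> b w gb; apply: contrapT => nb.
have [y Dy ny] := cl_avoid (countable_range _) (@subset_refl _ _) fD gb.
apply: ny; rewrite range_scons; apply: (mat_exch matroid_cl) nb.
apply: (mat_mono matroid_cl) (nchi _ _ Dy) => _ [i _ <-] /=.
by case: (f i) => [|j]; [right|left; exists j].
Qed.

Lemma matroid_tcl : matroid (@tcl K).
Proof.
split; [exact: tcl_sub|exact: tcl_mono| | |by move=> X a c []; exact: tcl_exch].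
  by move=> X; apply/seteqP; split; [exact: tcl_trans|exact: tcl_sub].
move=> X; apply/seteqP; split=> a.
  move=> /tcl_fin[n [z [Xz h]]]; exists (X `&` z @` `I_n).
    split=> [|x []//]; apply: sub_finite_set (@subIsetr _ _ _) _.
    exact/finite_image/finite_II.
  apply: tcl_trans h => _ [i lt <-]; case: (Xz i) => [Xi|->]; last exact: tcl_zer.
  by apply: tcl_sub; split=> //; exists i.
by move=> [A [_ AX]]; apply: tcl_mono.
Qed.

Lemma nrw_proper chi (z : nat -> K) : models K T ->
  fo chi -> nrw chi -> exists x, ~ chi K (scons x z).
Proof.
move=> KT fchi nchi.
apply: (fo_transfer (D := fun N v => exists x, ~ chi N (scons x v))) KT z.
  by apply: fo_ex; apply: fo_not; apply: fo_ext fchi => N v; rewrite sconsE.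
move=> v; have [a na] := cl_proper (countable_range v).
by exists a => /nchi.
Qed.

End Closure.

(** * Elimination of coefficients *)

Definition ev (U : Type) (v : nat -> U) : nat -> U := fun i => v i.*2.
Definition od (U : Type) (v : nat -> U) : nat -> U := fun i => v i.*2.+1.

Lemma ev_mix (U : Type) (u z : nat -> U) : ev (mix u z) = u.
Proof. exact: mix_even. Qed.

Lemma od_mix (U : Type) (u z : nat -> U) : od (mix u z) = z.
Proof. exact: mix_odd. Qed.

Lemma mixE (U : Type) (v : nat -> U) : mix (ev v) (od v) = v.
Proof.
apply: funext => i; rewrite /mix /ev /od.
by rewrite -[in RHS](odd_double_half i); case: odd.
Qed.

(** Narrowness with the variables in two groups: [u] is kept, with [u 0] the narrow variable, and
    the coefficients [z] are to be eliminated. *)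
Definition nrw_mix D := forall u z : nat -> M,
  D M (mix u z) -> cl (range (u \o succn) `|` range z) (u 0).

Section Elimination.
Variable K : structure L.
Implicit Types (B : set K) (R : set (nat -> K)).

Definition traces B R := exists D, [/\ fo D, nrw_mix D & exists2 z,
  (forall i, B (z i) \/ z i = zer K) & forall u, R u <-> D K (mix u z)].

Lemma range_tcl B (z : nat -> K) : (forall i, B (z i) \/ z i = zer K) -> range z `<=` tcl B.
Proof. by move=> Bz _ [i _ <-]; case: (Bz i) => [/tcl_sub//|->]; apply: tcl_zer. Qed.

(** Only an implication on sequences from [tcl B] is obtained: a quantifier forgets the value of
    [c], and when it is the generic one, [c] has to be generic over [u]. *)
Lemma traces_del B c R : traces (B `|` [set c]) R ->
  exists2 R', traces B R' & forall u, range u `<=` tcl B -> R u -> R' u.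
Proof.
move=> [D [fD nD [z Bz RD]]].
have [f [z' [Bz' ez]]] := split_env Bz; rewrite {}ez in RD.
have [[th [fth nth [w Bw thc]]]|nc] := pselect (tcl B c).
  pose D' (N : structure L) (v : nat -> N) := exists y, th N (scons y (od (od v))) /\
    D N (mix (ev v) (scons y (ev (od v)) \o f)).
  exists (fun u => D' K (mix u (mix z' w))).
    exists D'; split.
    - apply: fo_ex; apply: fo_and.
        apply: (fo_sub (f := scons 0 (fun i => i.*2.+1.*2.+2))) fth _.
        by move=> N v [].
      apply: (fo_sub (f := mix (fun i => i.*2.+1) (scons 0 (fun i => i.*2.*2.+2) \o f))) fD _.
      move=> N v i; rewrite /mix; case: odd => //=.
      by case: (f _).
    - move=> u v [y []]; rewrite ev_mix od_mix => /nth hy /nD.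
      apply: (mat_trans matroid_cl) => x [?|]; first by apply: (mat_sub matroid_cl); left.
      move=> [i _ <-] /=; case: (f i) => [|j] /=.
        by apply: (mat_mono matroid_cl) hy => _ [k _ <-]; right; eexists.
      by apply: (mat_sub matroid_cl); right; eexists.
    - by exists (mix z' w) => // i; rewrite /mix; case: odd.
  move=> u Bu /RD Du; exists c; rewrite !od_mix !ev_mix; split=> //.
pose D1 (N : structure L) (v : nat -> N) :=
  D N (mix (ev (v \o succn)) (scons (v 0) (od (v \o succn)) \o f)).
have fD1 : fo D1.
  apply: (fo_sub (f := mix (fun i => i.*2.+1) (scons 0 (fun i => i.*2.+2) \o f))) fD _.
  by move=> N v i; rewrite /mix; case: odd => //=; case: (f _).
exists (fun u => gen D1 (mix u z')).
  exists (gen D1); split; [exact: fo_gen| |by exists z'].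
  (* Some [y] generic over all of [u] and [v] satisfies [D1]; if [u 0] were not in the required
     closure, exchange would make [y] dependent on [u] and [v]. *)
  move=> u v gD; apply: contrapT => nu.
  have [y] := cl_avoid (countable_range _) (@subset_refl _ _) fD1 gD.
  rewrite /D1 /= [ev _]ev_mix [od _]od_mix => /nD h; apply.
  have : cl (range (u \o succn) `|` range v `|` [set u 0]) y.
    apply: (mat_exch matroid_cl) nu; apply: (mat_mono matroid_cl) h.
    move=> x [?|[i _ <-]] /=; first by left; left.
    by case: (f i) => [|j]; [right|left; right; exists j].
  apply: (mat_mono matroid_cl); rewrite range_mix => x [[|]|->]; [|by right|by left; exists 0].
  by move=> [i _ <-]; left; exists i.+1.
move=> u Bu /RD Du; apply/(tcl_genP (a := c) fD1).
  apply: contra_not nc; apply: tcl_trans; rewrite range_mix => x [/Bu//|].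
  exact: range_tcl.
by rewrite /D1 /= [ev _]ev_mix [od _]od_mix.
Qed.

(** Adding to [B] the finitely many entries of [z] that matter makes the claim trivial; [traces_del]
    then takes them away one at a time. *)
Lemma elimination B D (z : nat -> K) : fo D -> nrw_mix D ->
  exists D' z', [/\ fo D', nrw_mix D', forall i, B (z' i) \/ z' i = zer K
    & forall u, range u `<=` tcl B -> D K (mix u z) -> D' K (mix u z')].
Proof.
move=> fD nD; have [n Hn] := fo_support fD.
pose R u := D K (mix u z); 
suff : exists D' z', [/\ fo D', nrw_mix D', forall i, B (z' i) \/ z' i = zer K
    & forall u, range u `<=` tcl B -> R u -> D' K (mix u z')] by [].
have {Hn} : traces (B `|` z @` `I_n) R.
  exists D; split=> //; exists (fun i => if i < n then z i else zer K) => [i|u].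
    by case: ifP => lt; [left; right; exists i|right].
  split; apply: Hn => i lt; rewrite /mix; case: odd => //.
    by rewrite (leq_ltn_trans (half_leq (leqnn _)) _)// ltn_half_double // -addnn ltn_addr.
  by rewrite (leq_ltn_trans (half_leq (leqnn _)) _)// ltn_half_double // -addnn ltn_addr.
elim: n R => [|n IH] R.
  rewrite II0 image_set0 setU0 => -[D' [fD' nD' [z' Bz' RD]]].
  by exists D', z'; split=> // u _ /RD.
rewrite (_ : B `|` _ = (B `|` z @` `I_n) `|` [set z n]); last first.
  apply/seteqP; split=> x.
    move=> [?|[i /=]]; first by left; left.
    by rewrite ltnS leq_eqVlt => /orP[/eqP->|lt] <-; [right|left; right; exists i].
  move=> [[?|[i /= lt <-]]|->]; [by left| |by right; exists n => /=].
  by right; exists i => //=; rewrite ltnS ltnW.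
move=> /traces_del[R' /IH[D' [z' [fD' nD' Bz' H]]] RR'].
exists D', z'; split=> // u uB Ru; apply: H => //; apply: RR' => //.
by apply: subset_trans uB _; apply: tcl_mono; left.
Qed.

Lemma elementary_substructure_forall (F : set K) D (z : nat -> K) :
  elementary_substructure F -> fo D ->
  (forall i, F (z i)) -> (forall x, F x -> D K (scons x z)) -> forall x, D K (scons x z).
Proof.
move=> [h el] fD Fz FD.
have elD v : D (substructure h) v <-> D K (fun i => sval (v i)).
  by case: (fD) => n [phi H]; rewrite -!H (el n phi (res v)).
have [n [phi H]] : fo (fun N v => forall x, D N (scons x v)).
  by apply: fo_all; apply: fo_ext fD => N v; rewrite sconsE.
pose z' i : substructure h := exist _ (z i) (Fz i).
apply/(H K z); apply/(el n phi (res z')); apply/H => x; apply/elD.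
rewrite (_ : (fun i => _) = scons (sval x) z); last by apply: funext => -[].
exact/FD/svalP.
Qed.

End Elimination.

(** * Elementary closed subsets are dense *)

(** Finite tuples are padded with zeros, which lie in every closure; [formula_over] gives the way
    back. *)
Lemma transferE (K : structure L) (X : set K) : transfer cl X = tcl X.
Proof.
apply/seteqP; split=> a.
  move=> [n [phi [b [nphi Xb sphi]]]].
  exists (fun (N : structure L) v => sat phi (@res N (1 + n) v)); split; first exact: fo_sat.
    move=> x z; rewrite -vcat_res => /nphi.
    by apply: (mat_mono matroid_cl) => _ [i _ <-]; exists i.
  exists (fun i => if insub i is Some j then b j else zer K).
    by move=> i; case: insubP => [j _ _|_]; [left|right].
  rewrite -vcat_res; suff -> : res (fun i => if insub i is Some j then b j else zer K) = b by [].
  by apply: funext => j; rewrite /res valK.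
move=> [chi [fchi nchi [z Xz chia]]].
have [m [phi [p [w Hw [Xp Hphi Hp]]]]] := formula_over fchi Xz.
exists m, phi, p; split=> //; last exact/Hp.
move=> x b /Hphi /nchi; apply: (mat_trans matroid_cl) => _ [i _ <-].
by case: (Hw M b i) => [/(mat_sub matroid_cl)//|->]; exact: cl_zer.
Qed.

(** * Elementary embeddings *)

Section Embedding.
Variables (K M' : structure L) (e : K -> M').
Hypothesis e_elem : elementary e.

Lemma elementary_fo D (v : nat -> K) : fo D -> D K v <-> D M' (e \o v).
Proof. by case=> n [phi H]; rewrite -!H (e_elem phi (res v)). Qed.

Lemma elementary_zer : e (zer K) = zer M'.
Proof.
exact/(elementary_fo (D := fun N v => v 0 = zer N) (fun=> zer K) (fot_const (rs_zero S))).
Qed.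

Lemma elementary_tcl (X : set K) a : tcl X a -> tcl (e @` X) (e a).
Proof.
move=> [chi [fchi nchi [z Xz chia]]]; exists chi; split=> //; exists (e \o z) => [i|].
  by rewrite /=; case: (Xz i) => [Xi|->]; [left; exists (z i)|right; exact: elementary_zer].
by rewrite -comp_scons; apply/elementary_fo.
Qed.

Lemma closed_in_tcl (F : set K) : closed_in cl e F -> tcl F `<=` F.
Proof.
by move=> Fcl a /elementary_tcl Fa; rewrite -Fcl; rewrite /preimage /= transferE.
Qed.

End Embedding.

Definition pad (N : structure L) n (b : 'I_n -> N) : nat -> N :=
  fun i => if insub i is Some j then b j else zer N.

Lemma res_pad (N : structure L) n (b : 'I_n -> N) : res (pad b) = b.
Proof. by apply: funext => j; rewrite /res /pad valK. Qed.

Lemma pad_in (N : structure L) n (b : 'I_n -> N) (X : set N) :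
  (forall j, X (b j)) -> X (zer N) -> forall i, X (pad b i).
Proof. by move=> Xb X0 i; rewrite /pad; case: insubP. Qed.

(** Otherwise elimination yields a narrow relation with coefficients in [F] that still covers [F],
    hence covers [K] by elementarity, against [nrw_proper]. *)
Lemma elementary_not_covered (K : structure L) (F : set K) chi (z : nat -> K) :
  models K T -> elementary_substructure F -> tcl F `<=` F -> fo chi -> nrw chi ->
  exists2 x, F x & ~ chi K (scons x z).
Proof.
move=> KT elF Fcl fchi nchi; apply: contrapT => nex.
have Fchi x : F x -> chi K (scons x z).
  by move=> Fx; apply: contrapT => nx; apply: nex; exists x.
have F0 : F (zer K) by apply: Fcl; exact: tcl_zer.
(* Only the entry [u 0] is meaningful here; [chi'] below sets the others to zero. *)
pose D (N : structure L) (v : nat -> N) := chi N (scons (v 0) (od v)).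
have [||D' [z' [fD' nD' Fz' H]]] := elimination F (D := D) z.
- by apply: (fo_sub (f := scons 0 (fun i => i.*2.+1))) fchi _ => N v [].
- move=> u v; rewrite /D od_mix => /nchi; apply: (mat_mono matroid_cl) => x ?.
  by right.
pose chi' (N : structure L) (v : nat -> N) :=
  D' N (mix (scons (v 0) (fun=> zer N)) (v \o succn)).
have fchi' : fo chi'.
  apply: (fo_subt (E := fun N v x => D' N (mix (scons (v 0) (fun=> x)) (v \o succn))));
    last exact: fot_const.
  apply: (fo_sub (f := mix (scons 1 (fun=> 0)) (fun i => i.+2))) fD' _ => N v i.
  by rewrite /mix; case: odd => //=; case: i./2.
have nchi' : nrw chi'.
  move=> x w /nD'; apply: (mat_trans matroid_cl) => y [[i _ <-]|]; first exact: cl_zer.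
  exact: (mat_sub matroid_cl).
have [x []] := nrw_proper z' KT fchi' nchi'.
move: x; apply: (elementary_substructure_forall elF fchi').
  by move=> i; case: (Fz' i) => [//|->].
move=> x Fx; apply: H.
  by apply: subset_trans (@tcl_sub _ F); move=> _ [[|i] _ <-].
by rewrite /D od_mix; apply: Fchi.
Qed.

(** The Tarski-Vaught condition. If [a] is outside the closed set [P], it is generic over the
    parameters, so the set has dimension 1 and density applies. *)
Lemma Td_meets (N : structure (pair_language L)) (kappa' : Type) (M' : structure L)
    (e : reduct N -> M') D (z : nat -> reduct N) (a : reduct N) :
  elementary e -> closed_in cl e (@Pset L N) -> dense_in cl e (@Pset L N) ->
  fo D -> (forall i, Pset (z i)) -> D (reduct N) (scons a z) ->
  exists2 x, Pset x & D (reduct N) (scons x z).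
Proof.
move=> e_el Pcl Pdense fD Pz Da.
have [?|nPa] := pselect (Pset a); first by exists a.
have [m [phi [p [w _ [Pp _ Hp]]]]] := formula_over (z0 := rs_zero S) fD (fun i => or_introl (Pz i)).
have [|x Px /Hp ?] := Pdense m phi p; last by exists x.
apply/has_dim1P; exists (fun=> e a).
  have := (e_el _ phi (vcat (fun _ : 'I_1 => a) p)).1 ((Hp a).2 Da).
  congr sat; apply: funext => i; rewrite /vcat /=.
  by case: fintype.split.
apply: contra_not nPa => h; rewrite -Pcl; move: h; rewrite /preimage /= !transferE.
by apply: tcl_mono => _ [i _ <-]; exists (p i).
Qed.

Lemma models_Td_T2 (N : structure (pair_language L)) : models_Td T cl N -> models_T2 T cl N.
Proof.
move=> [kappa' [M' [e [emb [NT Pprop Pcl Pdense]]]]].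
have [_ _ e_el] := emb.
exists kappa', M', e; split=> //; split=> //.
set F := @Pset L N in Pprop Pcl Pdense *.
have meets D z a := @Td_meets N kappa' M' e D z a e_el Pcl Pdense.
have F0 : F (zer (reduct N)) by apply: (closed_in_tcl e_el Pcl); exact: tcl_zer.
have hF : fun_closed F.
  move=> k f v Fv.
  have [|x Fx /=] := meets (fun (N : structure L) v => v 0 = fun_interp f (fun j : 'I_k => v j.+1))
    (pad v) (fun_interp f v) (fo_graph f (fun j => j.+1) 0) (pad_in Fv F0).
    by congr fun_interp; rewrite -[v in LHS]res_pad.
  by rewrite -[fun _ => pad v _]/(res (pad v)) res_pad => <-.
exists hF.
have eval_sub n (t : term L n) (v : 'I_n -> substructure hF) :
    sval (eval v t) = eval (fun i => sval (v i)) t.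
  elim: t => //= k f ts IH; congr fun_interp; apply: funext => i; exact: IH.
move=> n phi; elim: phi => {n} [n|n t u|n k R ts|n phi IH psi IH'|n phi IH] v //=.
- rewrite -!eval_sub; split=> [->//|]; exact: eq_sig_hprop.
- by under [in X in _ <-> X]eq_fun do rewrite -eval_sub.
- by rewrite IH IH'.
have ev x : sat phi (vcat (fun _ : 'I_1 => x) v) <->
    sat phi (vcat (fun _ : 'I_1 => sval x) (fun i => sval (v i))).
  rewrite IH; suff -> : (fun x => sval x) \o vcat (fun _ : 'I_1 => x) v =
    vcat (fun _ : 'I_1 => sval x) (fun i => sval (v i)) by [].
  by apply: funext => i; rewrite /vcat /=; case: fintype.split.
split=> [h a|h x]; last exact/ev.
apply: contrapT => na.
have [|x Fx] := meets (fun (N : structure L) v => ~ sat phi (@res N n.+1 v))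
  (pad (fun i => sval (v i))) a
  (fo_not (fo_sat phi)) (pad_in (fun i => svalP (v i)) F0).
  by rewrite -vcat_res res_pad.
by rewrite -vcat_res res_pad; apply; apply/(ev (exist _ x Fx)).
Qed.

Lemma models_T2_Td (N : structure (pair_language L)) : models_T2 T cl N -> models_Td T cl N.
Proof.
move=> [kappa' [M' [e [emb [NT elF Pprop Pcl]]]]].
have [_ _ e_el] := emb.
exists kappa', M', e; split=> //; split=> //.
move=> n phi b /has_dim1P[v /= sv nv].
pose D (N : structure L) (w : nat -> N) := sat phi (@res N (1 + n) w).
have fD : fo D by exact: fo_sat.
have gD : gen D (pad b).
  apply/(elementary_fo e_el _ (fo_gen S fD)).
  apply/(tcl_genP (a := v ord0) fD).
    apply: contra_not nv; rewrite transferE; apply: tcl_trans => _ [i _ <-] /=.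
    rewrite /pad; case: insubP => [j _ _|_]; first by apply: tcl_sub; exists j.
    by rewrite (elementary_zer e_el); exact: tcl_zer.
  rewrite /D -vcat_res.
  rewrite (_ : res _ = e \o b); last by rewrite -[b in RHS]res_pad.
  by rewrite (_ : (fun=> v ord0) = v)//; apply: funext => i; rewrite ord1.
(* The complement of the large set is narrow, so it cannot cover [F]. *)
have [fchi nchi] := nrw_gen fD.
have [x Fx nx] := elementary_not_covered (pad b) NT elF (closed_in_tcl e_el Pcl) fchi nchi.
exists x => //; apply: contrapT => nphi; apply: nx; split=> //.
by rewrite /D -vcat_res res_pad.
Qed.

(** * Extensions avoiding the closure of the small model *)

Lemma countable_image_II (U : Type) (f : nat -> U) n : countable (f @` `I_n).
Proof. exact/finite_set_countable/finite_image/finite_II. Qed.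

Lemma independent_seq (U : Type) (clo : set U -> set U) (P B : set U) (d : U) k :
  (forall n (y : nat -> U), exists2 x, P x & ~ clo (B `|` y @` `I_n) x) ->
  exists y, forall j, j <= k -> P (y j) /\ ~ clo (B `|` y @` `I_j) (y j).
Proof.
move=> ext; suff [y Hy] : exists y, forall j, j < k.+1 -> P (y j) /\ ~ clo (B `|` y @` `I_j) (y j).
  by exists y => j; rewrite -ltnS; apply: Hy.
elim: k.+1 => [|m [y Hy]].
  by exists (fun=> d).
have [x Px nx] := ext m y.
pose y' i := if i < m then y i else x.
have e j : j <= m -> y' @` `I_j = y @` `I_j.
  by move=> jm; apply: eq_imagel => i /= ij; rewrite /y' (leq_trans ij jm).
exists y' => j; rewrite ltnS => jm; rewrite e// /y'; case: ltnP => [|mj]; first exact: Hy.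
by have -> : j = m by apply/eqP; rewrite eqn_leq jm.
Qed.

Lemma nrw_fot t : fot t -> nrw (fun N v => v 0 = t N (v \o succn)).
Proof.
move=> [n [phi H]] a z e; apply: cl_of_fixed => [|g ag gz]; first exact: countable_range.
have gE : g \o z = z by apply: funext => i; apply: gz; exists i.
have /(aut_sat ag) : sat phi (res (scons a z)) by apply/H.
rewrite -[g \o _]/(res (g \o scons a z)) comp_scons gE => /H/= ->.
exact: esym.
Qed.

Lemma tcl_fot (K : structure L) t (z : nat -> K) : fot t -> tcl (range z) (t K z).
Proof. by move=> ft; apply: (tclI ft (nrw_fot ft)). Qed.

Lemma tcl_hor (K : structure L) (X : set K) (q : nat -> K) y k :
  (forall i, tcl X (q i)) -> tcl X y -> tcl X (hor q y k).
Proof.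
move=> Xq Xy; have : tcl (range (scons y q)) (hor q y k).
  apply: (tcl_fot (t := fun N v => hor (v \o succn) (v 0) k) (scons y q)).
  by apply: (@fot_hor L S k (fun N v => v \o succn) (fun N v => v 0)) => [i|]; exact: fot_var.
by apply: tcl_trans; rewrite range_scons => x [[i _ <-]|->].
Qed.

(* [hor _ y k] is determined by its values at the [k + 1] independent points [y j], which can
   afterwards be removed by exchange. *)
Lemma cl_interpolation (G : set M) (q y : nat -> M) k : countable G ->
  (forall j, j <= k -> ~ cl (range q `|` G `|` y @` `I_j) (y j)) ->
  (forall j, j <= k -> cl (G `|` [set y j]) (hor q (y j) k)) ->
  forall i, i <= k -> cl G (q i).
Proof.
move=> cG yind Gh i ik; pose Y := y @` `I_k.+1.
have cq : cl (G `|` Y) (q i).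
  pose C := Y `|` [set hor q (y j) k | j in `I_k.+1].
  have : cl C (q i).
    apply: cl_of_fixed => [|g ag gC].
      exact: countable_union (countable_image_II _ _) (countable_image_II _ _).
    apply: esym; apply: (horn_inj (T_domains M_models) (y := y) (q' := g \o q) (k := k) _ _ ik).
      have lt_neq j1 j2 : j2 <= k -> j1 < j2 -> y j1 <> y j2.
        move=> j2k lt e; apply: (yind j2 j2k); apply: (mat_sub matroid_cl).
        by right; exists j1.
      move=> j1 j2 j1k j2k e; have [lt|lt|//] := ltngtP j1 j2.
        by have := lt_neq _ _ j2k lt e.
      by have := lt_neq _ _ j1k lt (esym e).
    move=> j jk; rewrite -[LHS](gC _) ?(aut_hor _ _ _ ag); last by right; exists j.
    by rewrite gC//; left; exists j.
  apply: (mat_trans matroid_cl) => x [Yx|[j /= jk <-]].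
    by apply: (mat_sub matroid_cl); right.
  apply: (mat_mono matroid_cl) (Gh j jk) => x' [?|->]; first by left.
  by right; exists j.
move: cq; rewrite /Y; elim: {1 3}k.+1 (leqnn k.+1) => [|m IH] mk.
  by rewrite II0 image_set0 setU0.
move=> cq; apply: (IH (ltnW mk)); apply: contrapT => ncq; apply: (yind m) => //.
have : cl (G `|` y @` `I_m `|` [set q i]) (y m).
  apply: (mat_exch matroid_cl) ncq; apply: (mat_mono matroid_cl) cq.
  move=> x [?|[j /=]]; first by left; left.
  by rewrite ltnS leq_eqVlt => /orP[/eqP->|lt] <-; [right|left; right; exists j].
by apply: (mat_mono matroid_cl) => x [[?|?]|->]; [left; right|right|left; left; exists i].
Qed.

Section Pair.
Variables (N : structure (pair_language L)) (kappa' : Type).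
Hypothesis N_large : card_lt [set: {n & formula (pair_language L) n}] [set: kappa'].
Hypothesis N_saturated : saturated kappa' N.
Hypothesis N_models : models (reduct N) T.
Let P : set (reduct N) := @Pset L N.
Hypothesis P_elementary : elementary_substructure P.
Hypothesis P_closed : tcl P `<=` P.
Hypothesis P_proper : P <> setT.

Lemma P_zer : P (zer (reduct N)).
Proof. by apply: P_closed; exact: tcl_zer. Qed.

Lemma fo_P : fo (fun (N : structure (pair_language L)) v => Pset (v 0 : reduct N)).
Proof.
apply: fo_ext (fo_rel (PSymb L : rel_symb (pair_language L) 1) (fun=> 0)) => N' v.
by [].
Qed.

Lemma N_small (U : Type) (A : set U) : countable A -> small kappa' A.
Proof. exact: (countable_small N_large). Qed.

(** Saturation applied to the ideal of sets whose trace on [P] is contained in a narrow set. The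
    complement of [P] has empty trace, so the point found is in [P]. *)
Lemma P_generic (A : set (reduct N)) : small kappa' A -> exists2 x, P x & ~ tcl A x.
Proof.
move=> sA.
pose I (Y : set N) := exists chi, [/\ fo chi, nrw chi & exists z : nat -> reduct N,
  forall y, P y -> Y y -> chi (reduct N) (scons y z)].
have false_nrw : nrw (fun (N : structure L) v => False) by [].
have [||||x Hx] := @saturated_ideal (pair_language L) (rs_zero S) kappa' N A I N_saturated sA.
- move=> Y Z [c1 [f1 n1 [z1 H1]]] [c2 [f2 n2 [z2 H2]]].
  exists (fun N v => c1 N (scons (v 0) (ev (v \o succn))) \/ c2 N (scons (v 0) (od (v \o succn)))).
  split.
  + apply: fo_or.
      by apply: (fo_sub (f := scons 0 (fun i => i.*2.+1))) f1 _ => N' v [].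
    by apply: (fo_sub (f := scons 0 (fun i => i.*2.+2))) f2 _ => N' v [].
  + by move=> a z [/n1|/n2]; apply: (mat_mono matroid_cl) => _ [i _ <-]; eexists.
  + exists (mix z1 z2) => y Py /=; rewrite [ev _]ev_mix [od _]od_mix.
    by case=> [/(H1 y Py)|/(H2 y Py)]; [left|right].
- move=> Y Z YZ [chi [f n [z H]]]; exists chi; split=> //; exists z => y Py /YZ.
  exact: H.
- by exists (fun _ _ => False); split=> //; [exact: fo_false|exists (fun=> zer _)].
- move=> [chi [f n [z H]]].
  have [x Px] := elementary_not_covered z N_models P_elementary P_closed f n.
  by apply; apply: H.
exists x.
  apply: contrapT; apply: (Hx _ (fun=> zer (reduct N)) (fo_not fo_P)) => [i|].
    by right.
  exists (fun _ _ => False); split=> //; first exact: fo_false.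
move=> [chi [f n [z Az]]]; apply: (Hx _ z (fo_pair f) Az).
by exists chi; split=> //; exists z.
Qed.

Lemma smallness chi (z : nat -> reduct N) : fo chi -> nrw chi ->
  exists x, forall w, (forall i, P (w i)) -> ~ chi (reduct N) (scons x (mix w z)).
Proof.
move=> fchi nchi; apply: contrapT => nex.
have {nex} cov x : exists2 w, (forall i, P (w i)) & chi (reduct N) (scons x (mix w z)).
  apply: contrapT => nw; apply: nex; exists x => w Pw chiw; apply: nw.
  by exists w.
(* At most [k] entries of [w] matter, against the [k + 1] coefficients of the polynomial used
   below. *)
have [k Hk] := fo_support fchi.
have {cov} cov x : exists w, [/\ forall i, P (w i), forall i, k <= i -> w i = zer (reduct N)
    & chi (reduct N) (scons x (mix w z))].
  have [w Pw h] := cov x; exists (fun i => if i < k then w i else zer (reduct N)); split=> [i|i|].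
  - by case: ifP => _ //; exact: P_zer.
  - by rewrite leqNgt => /negbTE->.
  apply: Hk h => -[|i] //= lt; rewrite /mix; case: odd => //.
  by rewrite (leq_ltn_trans _ (ltnW lt))// leq_half_double -addnn -addnS leq_addr.
have [y nPy] : exists y, ~ P y.
  apply: contrapT => h; apply: P_proper; apply/seteqP; split=> // x _.
  by apply: contrapT => nx; apply: h; exists x.
pose D (N : structure L) (v : nat -> N) := chi N (scons (v 0) (mix (ev v \o succn) (od v))).
have fD : fo D.
  apply: (fo_sub (f := scons 0 (mix (fun i => i.*2.+2) (fun i => i.*2.+1)))) fchi _.
  by move=> N' v [|i] //=; rewrite /mix; case: odd.
have nD : nrw_mix D.
  move=> u v; rewrite /D ev_mix od_mix => /nchi.
  by rewrite range_mix.
(* The covering will be applied to [hor q' y k] with [q'] in [P], which lies in the closure of [P]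
   and [y]; hence [z] can be replaced by [y] and coefficients [f0] in [P]. *)
have [D' [z' [fD' nD' Bz' H]]] := elimination (P `|` [set y]) z fD nD.
have [g [f0 [Pf0 ez']]] := split_env Bz'; rewrite {}ez' {Bz'} in H.
have {}Pf0 i : P (f0 i) by case: (Pf0 i) => [//|->]; exact: P_zer.
(* The variables are [y], then [mix q (mix w f0)]. *)
pose D3 (N : structure L) (v : nat -> N) := D' N
  (mix (scons (hor (ev (v \o succn)) (v 0) k) (ev (od (v \o succn))))
       (scons (v 0) (od (od (v \o succn))) \o g)).
have fD3 : fo D3.
  apply: (fo_subt (E := fun N v x => D' N (mix (scons x (ev (od (v \o succn))))
       (scons (v 0) (od (od (v \o succn))) \o g)))).
    apply: (fo_sub (f := mix (scons 0 (fun i => i.*2.*2.+3))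
      (scons 1 (fun i => i.*2.+1.*2.+3) \o g))) fD' _ => N' v i.
    by rewrite /mix; case: odd => /=; [case: (g _)|case: i./2].
  apply: (@fot_hor L S k (fun N v => ev (v \o succn)) (fun N v => v 0)) => [i|]; exact: fot_var.
have D3E (N' : structure L) (a : N') q w f : D3 N' (scons a (mix q (mix w f))) =
    D' N' (mix (scons (hor q a k) w) (scons a f \o g)).
  by rewrite /D3 /= [ev (_ \o _)]ev_mix [od (_ \o _)]od_mix ev_mix od_mix.
(* In [M] the generic argument can be each of [k + 1] independent points, and interpolation recovers
   [q]. *)
have ME (q w f : nat -> M) : gen D3 (mix q (mix w f)) ->
    forall i, i <= k -> cl (range w `|` range f) (q i).
  move=> gD; have cG : countable (range w `|` range f).
    exact: countable_union (countable_range _) (countable_range _).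
  have [|a Ha] := @independent_seq M cl setT (range q `|` (range w `|` range f)) (zer M) k.
    move=> n a; have [|x nx] := @cl_proper (range q `|` (range w `|` range f) `|` a @` `I_n).
      apply: countable_union; first exact: countable_union (countable_range _) cG.
      exact: countable_image_II.
    by exists x.
  apply: (cl_interpolation (y := a) cG) => j jk; first exact: (Ha j jk).2.
  have : D3 M (scons (a j) (mix q (mix w f))).
    apply/(genP fD3) => //; rewrite !range_mix.
    by move=> /(mat_mono matroid_cl (@subsetUl _ _ _))/(Ha j jk).2.
  rewrite D3E => /nD'; apply: (mat_mono matroid_cl) => x [?|[i _ <-]] /=; first by left; left.
  by case: (g i) => [|i'] /=; [right|left; right; exists i'].
(* By [ME], being the entry [i] of some [q] with [gen D3] is a narrow property; [fo_ex_env] makes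
   the quantifier over [q] first-order. *)
have KE (q w f : nat -> reduct N) : gen D3 (mix q (mix w f)) ->
    forall i, i <= k -> tcl (range w `|` range f) (q i).
  move=> gD i ik; rewrite -range_mix.
  pose D4 (N : structure L) (v : nat -> N) :=
    gen D3 (mix (ev v) (od v \o succn)) /\ ev v i = od v 0.
  apply: (tclI (chi := fun N v => exists q, (forall i, True \/ q i = zer N) /\ D4 N (mix q v))).
  - apply: (@fo_ex_env L (rs_zero S) (fun N x => True)).
      by apply: fo_ext (fo_not (fo_false L)) => N' v; split=> // _ [].
    apply: fo_and; last exact: (fo_eqv L i.*2 1).
    apply: (fo_sub (f := mix double (fun i => i.*2.+3))) (fo_gen S fD3) _ => N' v j.
    by rewrite /mix; case: odd.
  - move=> a v [q' [_ []]]; rewrite ev_mix od_mix /= => gq <-.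
    by move: gq; rewrite -[v in mix q' v]mixE => /ME/(_ i ik); rewrite -range_mix mixE.
  exists q; split=> [j|]; first by left.
  by rewrite /D4 ev_mix od_mix.
have [|q Hq] := @independent_seq (reduct N) (@tcl (reduct N)) P (range f0) y k.
  move=> n a; have [|x Px nx] := P_generic (A := range f0 `|` a @` `I_n); last by exists x.
  apply: N_small; apply: countable_union; first exact: countable_range.
  exact: countable_image_II.
pose q' i := if i <= k then q i else zer (reduct N).
have Pq' i : P (q' i) by rewrite /q'; case: ifP => [/Hq[]//|_]; exact: P_zer.
have [w [Pw w0 chiw]] := cov (hor q' y k).
have Ptcl : P `<=` tcl (P `|` [set y]).
  by move=> x Px; apply: tcl_sub; left.
have D3w : D3 (reduct N) (scons y (mix q' (mix w f0))).
  rewrite D3E; apply: H; last by rewrite /D [ev _]ev_mix od_mix.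
  rewrite range_scons => x [[i _ <-]|->]; first exact/Ptcl.
  apply: tcl_hor => [i|]; first exact/Ptcl.
  by apply: tcl_sub; right.
(* [y] is outside the closed set [P], which contains all these coefficients. *)
have gw : gen D3 (mix q' (mix w f0)).
  apply/(tcl_genP fD3); last exact: D3w.
  apply: contra_not nPy => h; apply: P_closed; move: h; apply: tcl_mono.
  by rewrite !range_mix => x [[i _ <-]|[[i _ <-]|[i _ <-]]].
(* The [k + 1] coefficients lie in the closure of [f0] and [k] entries of [w], so they are dependent
   over [f0], against their choice. *)
have [|i ik hi] := mat_steinitz (matroid_tcl (reduct N))
  (X := range f0) (p := w) (q := q') (k := k).
  move=> i ik; apply: tcl_trans (KE _ _ _ gw i ik) => x [[j _ <-]|?]; last first.
    by apply: tcl_sub; left.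
  have [lt|/w0->] := ltnP j k; last exact: tcl_zer.
  by apply: tcl_sub; right; exists j.
apply: (Hq i ik).2; move: hi; rewrite {2}/q' ik.
rewrite (_ : q' @` `I_i = q @` `I_i)//.
by apply: eq_imagel => j /= ji; rewrite /q' (leq_trans (ltnW ji) ik).
Qed.

(** Saturation applied to the ideal of sets covered by a narrow relation whose coefficients are a
    fixed [z] and a varying [w] in [P]; it is proper by [smallness]. *)
Lemma scl_proper (A : set (reduct N)) : small kappa' A -> exists x, ~ tcl (A `|` P) x.
Proof.
move=> sA.
pose I (Y : set N) := exists chi, [/\ fo chi, nrw chi & exists z : nat -> reduct N,
  forall y, Y y -> exists2 w, (forall i, P (w i)) & chi (reduct N) (scons y (mix w z))].
have [||||x Hx] := @saturated_ideal (pair_language L) (rs_zero S) kappa' N A I N_saturated sA.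
- move=> Y Z [c1 [f1 n1 [z1 H1]]] [c2 [f2 n2 [z2 H2]]].
  exists (fun N v => c1 N (scons (v 0) (mix (ev (ev (v \o succn))) (ev (od (v \o succn))))) \/
    c2 N (scons (v 0) (mix (od (ev (v \o succn))) (od (od (v \o succn)))))).
  split.
  + apply: fo_or.
      apply: (fo_sub (f := scons 0 (mix (fun i => i.*2.*2.+1) (fun i => i.*2.*2.+2)))) f1 _.
      by move=> N' v [|i] //=; rewrite /mix; case: odd.
    apply: (fo_sub (f := scons 0
      (mix (fun i => i.*2.+1.*2.+1) (fun i => i.*2.+1.*2.+2)))) f2 _.
    by move=> N' v [|i] //=; rewrite /mix; case: odd.
  + by move=> a z [/n1|/n2]; apply: (mat_mono matroid_cl); rewrite range_mix =>
      _ [[i _ <-]|[i _ <-]];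
      eexists.
  + exists (mix z1 z2) => y [/H1[w Pw c1w]|/H2[w Pw c2w]]; exists (mix w w) => [i|];
      rewrite ?[ev (_ \o _)]ev_mix ?[od (_ \o _)]od_mix ?ev_mix ?od_mix; do ?by [left|right];
      by rewrite /mix; case: odd.
- move=> Y Z YZ [chi [f n [z H]]]; exists chi; split=> //; exists z => y /YZ.
  exact: H.
- exists (fun _ _ => False); split=> //; first exact: fo_false.
  by exists (fun=> zer _).
- move=> [chi [f n [z H]]]; have [x nx] := smallness z f n.
  by have [w /nx] := H x Logic.I.
exists x => -[chi [f n [z Az]]].
(* The coefficients in [A] remain parameters; the others, in [P] or zero, become values of the
   quantified sequence. *)
pose zA i := if `[< A (z i) >] then z i else zer (reduct N).
pose w0 i := if `[< A (z i) >] then zer (reduct N) else z i.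
pose sel (U : Type) (w v : nat -> U) i := if `[< A (z i) >] then v i else w i.
have zE : z = sel _ w0 zA by apply: funext => i; rewrite /sel /w0 /zA; case: asboolP.
have Pw0 i : P (w0 i).
  rewrite /w0; case: asboolP => [_|nA]; first exact: P_zer.
  by case: (Az i) => [[]//|->]; exact: P_zer.
pose chi' (N : structure L) (v : nat -> N) :=
  chi N (scons (v 0) (sel _ (ev (v \o succn)) (od (v \o succn)))).
have fchi' : fo chi'.
  apply: (fo_sub (f := scons 0 (sel _ (fun i => i.*2.+1) (fun i => i.*2.+2)))) f _ => N' v [|i] //=.
  by rewrite /sel; case: ifP.
pose D0 (N : structure L) (v : nat -> N) := chi' N (scons (od v 0) (mix (ev v) (od v \o succn))).
have fD0 : fo D0.
  apply: (fo_sub (f := scons 1 (mix double (fun i => i.*2.+3)))) fchi' _ => N' v [|i] //=.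
  by rewrite /mix; case: odd.
have D0E (w v : nat -> reduct N) y :
    D0 (reduct N) (mix w (scons y v)) = chi' (reduct N) (scons y (mix w v)).
  by rewrite /D0 od_mix ev_mix.
have fEx := @fo_ex_env (pair_language L) (rs_zero S) (fun N x => @Pset L N x) _ fo_P (fo_pair fD0).
move=> chix; refine (Hx _ zA fEx _ _ _).
- by move=> i; rewrite /zA; case: asboolP; [left|right].
- exists chi'; split=> //.
    move=> a v /n; apply: (mat_mono matroid_cl) => _ [i _ <-] /=.
    by rewrite /sel; case: ifP => _; eexists.
  exists zA => y /= [w [Pw h]]; exists w; last by rewrite -D0E.
  by move=> i; case: (Pw i) => [//|->]; exact: P_zer.
exists w0; split=> [i|]; first by left; exact: Pw0.
by rewrite D0E /chi' /= [ev (_ \o _)]ev_mix [od (_ \o _)]od_mix -zE.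
Qed.

(** * Back and forth *)

(* Independence of [z] from [P] over the part of [z] in [P], stated without ranks. *)
Definition free (z : nat -> reduct N) := forall B, B `<=` P ->
  P `&` tcl (range z `|` B) `<=` tcl ((range z `&` P) `|` B).

Lemma free_zer : free (fun=> zer (reduct N)).
Proof.
move=> B BP x [_]; apply: tcl_trans => y [[i _ <-]|By]; first exact: tcl_zer.
by apply: tcl_sub; right.
Qed.

Lemma range_sconsP (x : reduct N) z : range z `&` P `<=` range (scons x z) `&` P.
Proof. by rewrite range_scons => y [? ?]; split=> //; left. Qed.

Lemma free_cons_P x z : free z -> P x -> free (scons x z).
Proof.
move=> fz Px B BP y [Py]; rewrite range_scons -setUA => h.
have /fz fz' : [set x] `|` B `<=` P by move=> b [->|/BP].
apply: tcl_mono (fz' y (conj Py h)) => b [[? ?]|[->|?]]; last by right.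
- by left; split=> //; left.
- by left; split=> //; right.
Qed.

Lemma free_cons_tcl x z : free z -> tcl (range z) x -> free (scons x z).
Proof.
move=> fz zx B BP y [Py]; rewrite {1}range_scons => h.
have : tcl (range z `|` B) y.
  apply: tcl_trans h => b [[?|->]|?]; [by apply: tcl_sub; left| |by apply: tcl_sub; right].
  by apply: tcl_mono zx; left.
move=> h'; apply: tcl_mono (fz B BP y (conj Py h')) => b [/range_sconsP?|?]; first by left.
by right.
Qed.

(** If adding [x] captured a new [y] of [P], exchange would put [x] in the closure of [z] and
    [P]. *)
Lemma free_cons_generic x z : free z -> ~ tcl (range z `|` P) x -> free (scons x z).
Proof.
move=> fz nx B BP y [Py]; rewrite {1}range_scons => h.
have : tcl (range z `|` B) y.
  apply: contrapT => ny; apply: nx.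
  have : tcl (range z `|` B `|` [set y]) x.
    by apply: tcl_exch ny; apply: tcl_mono h => b [[?|?]|?]; [left; left|right|left; right].
  by apply: tcl_mono => b [[?|/BP]|->]; [left|right|right].
move=> h'; apply: tcl_mono (fz B BP y (conj Py h')) => b [/range_sconsP?|?]; first by left.
by right.
Qed.

Definition agree (z z' : nat -> reduct N) :=
  [/\ forall D, fo D -> D (reduct N) z <-> D (reduct N) z',
      forall i, P (z i) <-> P (z' i), free z & free z'].

Lemma agree_sym z z' : agree z z' -> agree z' z.
Proof.
by move=> [h hP f f']; split=> // [D fD|i]; [rewrite (h D fD)|rewrite hP].
Qed.

Lemma tcl_image (J : set nat) (z z' : nat -> reduct N) x x' :
  (forall D, fo D -> D (reduct N) (scons x z) -> D (reduct N) (scons x' z')) ->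
  tcl (z @` J) x -> tcl (z' @` J) x'.
Proof.
move=> same [chi [f n [w Jw chix]]].
have /choice[g Hg] : forall i, exists k : option nat,
    if k is Some j then J j /\ z j = w i else w i = zer (reduct N).
  by move=> i; case: (Jw i) => [[j Jj zj]|?]; [exists (Some j)|exists None].
pose D (N : structure L) (v : nat -> N) :=
  chi N (scons (v 0) (fun i => if g i is Some j then v j.+1 else zer N)).
have fD : fo D.
  apply: (fo_subt (E := fun N v y => chi N (scons (v 0)
    (fun i => if g i is Some j then v j.+1 else y)))); last exact: fot_const.
  apply: (fo_sub (f := scons 1 (fun i => if g i is Some j then j.+2 else 0))) f _ => N' v [|i] //=.
  by case: (g i).
have /(same D fD) Dx' : D (reduct N) (scons x z).
  rewrite /D /= (_ : (fun i => _) = w)//; apply: funext => i.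
  by have := Hg i; case: (g i) => [j []|->].
exists chi; split=> //; exists (fun i => if g i is Some j then z' j else zer (reduct N)) => //.
by move=> i; have := Hg i; case: (g i) => [j [Jj _]|_]; [left; exists j|right].
Qed.

(** By freeness [x] is in the closure of the entries of [z] in [P]. The corresponding entries of
    [z'] are in [P], which is closed. *)
Lemma P_image (z z' : nat -> reduct N) x x' :
  (forall D, fo D -> D (reduct N) (scons x z) -> D (reduct N) (scons x' z')) ->
  (forall i, P (z i) -> P (z' i)) -> free z -> tcl (range z) x -> P x -> P x'.
Proof.
move=> same Pz fz zx Px; apply: P_closed.
have {}zx : tcl (z @` [set i | P (z i)]) x.
  have := @fz set0 (sub0set _) x; rewrite !setU0 => /(_ (conj Px zx)).
  by apply: tcl_mono => _ [[i _ <-] ?]; exists i.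
by apply: tcl_mono (tcl_image same zx) => _ [i /Pz ? <-].
Qed.

Lemma agree_cons_tcl z z' x : agree z z' -> tcl (range z) x ->
  exists x', agree (scons x z) (scons x' z').
Proof.
move=> [h hP fz fz'] zx.
(* A point avoiding this ideal realizes over [z'] the [L]-type of [x] over [z]. *)
pose I (Y : set N) := exists D, [/\ fo D, ~ D (reduct N) (scons x z) &
  forall y, Y y -> D (reduct N) (scons y z')].
have [||||x' Hx'] := @saturated_ideal (pair_language L) (rs_zero S) kappa' N (range z') I
    N_saturated (N_small (countable_range _)).
- move=> Y Z [D1 [f1 n1 H1]] [D2 [f2 n2 H2]].
  exists (fun N v => D1 N v \/ D2 N v); split; [exact: fo_or|by case|].
  by move=> y [/H1|/H2]; [left|right].
- by move=> Y Z YZ [D [fD nD H]]; exists D; split=> // y /YZ/H.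
- by exists (fun _ _ => False); split=> //; exact: fo_false.
- move=> [D [fD nD H]]; apply: nD.
  have fall : fo (fun N v => forall y, D N (scons y v)).
    by apply: fo_all; apply: fo_ext fD => N' v; rewrite sconsE.
  by apply: ((h _ fall).2 _ x) => y; apply: H.
have same D : fo D -> D (reduct N) (scons x z) -> D (reduct N) (scons x' z').
  move=> fD Dx; apply: contrapT; apply: (Hx' _ z' (fo_pair (fo_not fD))) => [i|].
    by left; exists i.
  by exists (fun N v => ~ D N v); split=> //; exact: fo_not.
have same' D : fo D -> D (reduct N) (scons x' z') -> D (reduct N) (scons x z).
  move=> fD; apply: contraPP => nD; exact: (same _ (fo_not fD) nD).
have zx' : tcl (range z') x' by exact: tcl_image same zx.
exists x'; split; [by move=> D fD; split; [exact: same|exact: same']| | |].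
- case=> [|i] /=; last exact: hP.
  split; first by apply: (P_image same) => // i /hP.
  by apply: (P_image same') => // i /hP.
- exact: free_cons_tcl.
- exact: free_cons_tcl.
Qed.

(** At a generic element [D] amounts to [gen D], which belongs to the type of [z]. *)
Lemma generic_same (z z' : nat -> reduct N) x x' :
  (forall D, fo D -> D (reduct N) z <-> D (reduct N) z') ->
  ~ tcl (range z) x -> ~ tcl (range z') x' ->
  forall D, fo D -> D (reduct N) (scons x z) <-> D (reduct N) (scons x' z').
Proof.
by move=> h nx nx' D fD; rewrite (tcl_genP fD nx) (tcl_genP fD nx') (h _ (fo_gen S fD)).
Qed.

Lemma agree_cons_P z z' x : agree z z' -> P x ->
  exists x', agree (scons x z) (scons x' z').
Proof.
move=> a Px; have [|nx] := pselect (tcl (range z) x); first exact: agree_cons_tcl a.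
have [h hP fz fz'] := a.
have [x' Px' nx'] := P_generic (N_small (countable_range z')).
exists x'; split; [exact: generic_same| |exact: free_cons_P|exact: free_cons_P].
by case.
Qed.

Lemma agree_cons_generic z z' x x' : agree z z' ->
  ~ tcl (range z `|` P) x -> ~ tcl (range z' `|` P) x' ->
  agree (scons x z) (scons x' z').
Proof.
move=> [h hP fz fz'] nx nx'.
have sub (y : reduct N) (v : nat -> reduct N) :
    ~ tcl (range v `|` P) y -> ~ tcl (range v) y /\ ~ P y.
  move=> ny; split; apply: contra_not ny; first by apply: tcl_mono; left.
  by move=> Py; apply: tcl_sub; right.
have [? ?] := sub _ _ nx; have [? ?] := sub _ _ nx'.
split; [exact: generic_same| |exact: free_cons_generic|exact: free_cons_generic].
by case.
Qed.

(** Outside the closure of [z] and [P], [x] is matched with a point given by [scl_proper]. Otherwise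
    finitely many elements of [P] are added first, until [x] is in the closure of the sequence. [g]
    locates the old entries. *)
Lemma agree_forth z z' x : agree z z' -> exists z1 z1' g,
  [/\ agree z1 z1', z1 0 = x, z1 \o g = z, z1' \o g = z' &
      range z1 `<=` tcl (range z `|` P `|` [set x])].
Proof.
move=> a; have [|nx] := pselect (tcl (range z `|` P) x); last first.
  have sA : small kappa' (range z') by exact: N_small (countable_range _).
  have [x' nx'] := scl_proper sA.
  exists (scons x z), (scons x' z'), succn; split=> //.
    exact: agree_cons_generic.
  by rewrite range_scons => y [?|->]; apply: tcl_sub; [left; left|right].
move=> /tcl_fin[n [p [zPp px]]].
have [z1 [z1' [g [a1 e e' pz sz]]]] : exists z1 z1' g, [/\ agree z1 z1', z1 \o g = z,
    z1' \o g = z', forall i, i < n -> tcl (range z1) (p i) & range z1 `<=` range z `|` P].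
  elim: n {px} => [|n [z1 [z1' [g [a1 e e' pz sz]]]]].
    by exists z, z', id; split=> //; left.
  have [pn|npn] := pselect (tcl (range z1) (p n)).
    exists z1, z1', g; split=> // i; rewrite ltnS leq_eqVlt => /orP[/eqP->//|].
    exact: pz.
  have Ppn : P (p n).
    case: (zPp n) => [[[i _ zi]|//]|pn0]; case: npn; last by rewrite pn0; exact: tcl_zer.
    by apply: tcl_sub; rewrite -zi -e; exists (g i).
  have [y ay] := agree_cons_P a1 Ppn.
  exists (scons (p n) z1), (scons y z1'), (succn \o g); split=> //.
    move=> i; rewrite ltnS leq_eqVlt range_scons => /orP[/eqP->|/pz]; last by apply: tcl_mono; left.
    by apply: tcl_sub; right.
  by rewrite range_scons => b [/sz//|->]; right.
have zx : tcl (range z1) x.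
  by apply: tcl_trans px => _ [i /= lt <-]; exact: pz.
have [x' ax] := agree_cons_tcl a1 zx.
exists (scons x z1), (scons x' z1'), (succn \o g); split=> //.
by rewrite range_scons => y [/sz ?|->]; apply: tcl_sub; [left|right].
Qed.

(** * Types in the language of pairs *)

Lemma fo_sat_comp n (phi : formula L n) (f : 'I_n -> nat) :
  fo (fun N v => sat phi (fun j => v (f j))).
Proof.
pose f' i := if insub i is Some j then f j else 0.
apply: fo_ext (fo_sub (s := fun (N : structure L) v i => v (f' i)) (f := f')
  (fo_sat phi) _) => // N' v.
by rewrite /res /f'; under eq_fun do rewrite valK.
Qed.

Lemma fot_eval n (t : term L n) (f : 'I_n -> nat) :
  fot (fun N v => eval (fun j => v (f j)) t).
Proof.
pose f' (i : 'I_(1 + n)) := if fintype.split i is inr j then (f j).+1 else 0.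
have f'l : f' (lshift n ord0) = 0 by rewrite /f' -[lshift _ _]/(unsplit (inl _)) unsplitK.
have f'r j : f' (rshift 1 j) = (f j).+1 by rewrite /f' -[rshift _ _]/(unsplit (inr _)) unsplitK.
apply: fo_ext (fo_sat_comp (Eq (Var L (lshift n ord0)) (rename_term (@rshift 1 n) t)) f') => N' v.
rewrite /= f'l eval_rename; suff -> : (fun j => v (f' j)) \o @rshift 1 n =
  (fun j => (v \o succn) (f j)) by [].
by apply: funext => j /=; rewrite f'r.
Qed.

(** For the predicate [P], the value of a term is in the closure of the sequence and [P_image]
    applies; quantifiers are handled by [agree_forth]. *)
Lemma agree_sat n (phi : formula (pair_language L) n) z z' (f : 'I_n -> nat) :
  agree z z' -> sat phi (fun j => z (f j) : N) <-> sat phi (fun j => z' (f j) : N).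
Proof.
elim: phi z z' f => {n} [n|n t u|n k R ts|n phi IH psi IH'|n phi IH] z z' f a //=.
- rewrite !eval_unpair; have [h _ _ _] := a.
  exact: (h _ (fo_sat_comp (Eq (unpair_term t) (unpair_term u)) f)).
- have [h hP fz fz'] := a.
  case: R ts => [k' R|] ts.
    have := h _ (fo_sat_comp (Rel R (fun i => unpair_term (ts i))) f).
    rewrite /=; under eq_fun do rewrite -eval_unpair.
    by under [in X in _ <-> X]eq_fun do rewrite -eval_unpair.
  pose t := unpair_term (ts ord0).
  pose val (K : structure L) (v : nat -> K) := eval (fun j => v (f j)) t.
  have fval : fot val by exact: fot_eval.
  have tE v : (fun i => eval (fun j => v (f j) : N) (ts i)) = (fun=> val (reduct N) v).
    by apply: funext => i; rewrite ord1 eval_unpair.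
  rewrite !tE.
  have same D : fo D -> D (reduct N) (scons (val _ z) z) <-> D (reduct N) (scons (val _ z') z').
    move=> fD; apply: (h (fun K v => D K (scons (val K v) v))).
    apply: (fo_subt (E := fun K v x => D K (scons x v))) fval.
    by apply: fo_ext fD => K v; rewrite sconsE.
  split.
    apply: (P_image _ _ fz (tcl_fot z fval)) => [D fD|i]; first exact: (same D fD).1.
    exact: (hP i).1.
  apply: (P_image _ _ fz' (tcl_fot z' fval)) => [D fD|i]; first exact: (same D fD).2.
  exact: (hP i).2.
- by rewrite (IH z z' f a) (IH' z z' f a).
have forth y y' (g : 'I_n -> nat) : agree y y' ->
    (forall x, sat phi (vcat (fun _ : 'I_1 => x) (fun j => y (g j) : N))) ->
    forall x, sat phi (vcat (fun _ : 'I_1 => x) (fun j => y' (g j) : N)).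
  move=> {}a all x; have [z1' [z1 [g' [a1 e0 e' e _]]]] := agree_forth x (agree_sym a).
  pose f' (i : 'I_(1 + n)) := if fintype.split i is inr j then g' (g j) else 0.
  have vE (v v1 : nat -> N) : v1 \o g' = v ->
      (fun i => v1 (f' i)) = vcat (fun _ : 'I_1 => v1 0) (fun j => v (g j)).
    by move=> <-; apply: funext => i; rewrite /vcat /f'; case: fintype.split.
  rewrite -e0 -(vE _ _ e'); apply/(IH _ _ f' (agree_sym a1)).
  by rewrite (vE _ _ e).
by split; apply: forth => //; exact: agree_sym.
Qed.

(** Obtained by going forth from [z] paired with itself, one parameter at a time. *)
Lemma free_extension (A : set (reduct N)) (p : nat -> reduct N) n :
  (forall i, A (p i) \/ p i = zer (reduct N)) ->
  exists z, [/\ free z, range z `<=` tcl (A `|` P) & forall i, i < n -> range z (p i)].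
Proof.
move=> Ap; elim: n => [|n [z [fz sz pz]]].
  exists (fun=> zer (reduct N)); split=> //; first exact: free_zer.
  by move=> _ [_ _ <-]; exact: tcl_zer.
have a : agree z z by split.
have [z1 [_ [g [[_ _ fz1 _] z10 e _ sz1]]]] := agree_forth (p n) a.
exists z1; split=> [//|x /sz1|i].
  apply: tcl_trans => y [[/sz//|Py]|->]; first by apply: tcl_sub; right.
  by case: (Ap n) => [?|->]; [apply: tcl_sub; left|exact: tcl_zer].
rewrite ltnS leq_eqVlt => /orP[/eqP->|/pz[j _ <-]]; first by exists 0.
by rewrite -e; exists (g j).
Qed.

(** The parameters of a formula are placed in a free sequence [z] from the closure of [A] and [P].
    Both points stay generic over [z] and [P], so they extend the pair of [z] with itself. *)
Lemma scl_tp_unique (A : set N) (x x' : N) :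
  ~ tcl (A `|` P : set (reduct N)) x -> ~ tcl (A `|` P : set (reduct N)) x' ->
  tp A (fun _ : 'I_1 => x) = tp A (fun _ : 'I_1 => x').
Proof.
suff half (y y' : N) : ~ tcl (A `|` P : set (reduct N)) y ->
    ~ tcl (A `|` P : set (reduct N)) y' ->
    tp A (fun _ : 'I_1 => y) `<=` tp A (fun _ : 'I_1 => y').
  by move=> nx nx'; apply/seteqP; split; apply: half.
move=> ny ny' psi [Apsi sy]; split=> //; case: psi Apsi sy => m phi p /= Ap.
have [z [fz sz pz]] := @free_extension A (@pad (reduct N) m p) m
  (@pad_in (reduct N) m p (fun c => A c \/ c = zer (reduct N)) (fun j => or_introl (Ap j))
    (or_intror erefl)).
have /choice[g Hg] (j : 'I_m) : exists k, z k = p j.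
  have [k _ zk] := pz j (ltn_ord j); exists k; rewrite zk.
  by rewrite -[in RHS](@res_pad (reduct N) m p).
have ngen (c : N) : ~ tcl (A `|` P : set (reduct N)) c -> ~ tcl (range z `|` P) c.
  apply: contra_not; apply: tcl_trans => b [/sz//|Pb].
  by apply: tcl_sub; right.
have a : agree z z by split.
have ag := agree_cons_generic a (ngen _ ny) (ngen _ ny').
pose f (i : 'I_(1 + m)) := if fintype.split i is inr j then (g j).+1 else 0.
have fE (c : N) : vcat (fun _ : 'I_1 => c) p = (fun i => scons c z (f i) : N).
  by apply: funext => i; rewrite /vcat /f; case: fintype.split => j //=; rewrite Hg.
by rewrite /psat /= !fE => /(agree_sat phi f ag).
Qed.

Lemma pair_cl_minimal : @cl_minimal kappa' (pair_language L) N (@Scl L M cl N).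
Proof.
move=> A sA; have [x nx] := scl_proper sA.
have SclE (B : set N) : @Scl L M cl N B = tcl (B `|` P : set (reduct N)).
  by rewrite /Scl transferE.
exists (tp A (fun _ : 'I_1 => x)); split.
  split; first exact: complete_tp.
  apply/has_dim1P; exists (fun=> x) => [phi []//|]; by rewrite SclE.
move=> p [cp /has_dim1P[v pv]]; rewrite SclE => nv.
rewrite (complete_type_tp cp pv) (_ : v = fun=> v ord0); last first.
  by apply: funext => i; rewrite ord1.
exact: scl_tp_unique.
Qed.

End Pair.

End Existential.

Theorem lemma10p7 (L : language) (S : ring_symbols L) (T : theory L)
    (T_complete : complete T) (T_infinite : only_infinite_models T)
    (T_domains : expands_integral_domains S T)
    (kappa : Type) (M : structure L)
    (M_models : models M T) (M_monster : monster kappa M)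
    (cl : set M -> set M) (cl_existential : existential_matroid kappa cl)
    (T_minimal : cl_minimal kappa cl) :
  (forall (kappa' : Type) (N : structure (pair_language L)),
     models_Td T cl N -> monster kappa' N ->
     @cl_minimal kappa' (pair_language L) N (@Scl L M cl N))
  /\
  (forall N : structure (pair_language L), models_Td T cl N <-> models_T2 T cl N).
Proof.
have Td_T2 := @models_Td_T2 L S T kappa M M_monster cl cl_existential.
have T2_Td := models_T2_Td T_complete T_domains M_models M_monster cl_existential T_minimal.
split=> [kappa' N /Td_T2|N]; last by split; [exact: Td_T2|exact: T2_Td].
move=> [kappa'' [M' [e [[_ _ e_elem] [NT elP P_proper Pcl]]]]] [large saturatedN _].
apply: (pair_cl_minimal T_complete T_domains M_models M_monster cl_existential T_minimal
  large saturatedN NT elP _ P_proper).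
exact: (closed_in_tcl (S := S) M_monster cl_existential e_elem Pcl).
Qed.
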